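(* Let $G$ be the simple algebraic group of type $G_2$ over $\mathbb{C}$ and let $\underline{\Sigma_2}$ and $\Sigma_2^{(GLS)}$ be the two seeds described in the context. Put $\underline{\Sigma_2}^0=\mu_2\mu_3(\underline{\Sigma_2})$ (first $\mu_3$, then $\mu_2$). Then the seed $\mu_1\mu_3(\Sigma_2^{(GLS)})$ (first $\mu_3$, then $\mu_1$) has the same cluster as $\underline{\Sigma_2}^0$, and its exchange matrix is $-1$ times the exchange matrix of $\underline{\Sigma_2}^0$.
   Context: **Group.** $G$ is simple of type $G_2$ over $\mathbb{C}$, $\mathfrak{g}$ its Lie algebra, $B^{\pm}$ opposite Borel subgroups with unipotent radicals $N^{\pm}$, $H=B^+\cap B^-$, Chevalley generators $f_i,h_i,e_i$ ($i=1,2$), $x_i(t)=\exp(te_i)$, $y_i(t)=\exp(tf_i)$. Simple roots $\alpha_1$ (short), $\alpha_2$ (long); fundamental weights $\omega_1=2\alpha_1+\alpha_2$, $\omega_2=3\alpha_1+2\alpha_2$; Weyl group $W=\langle s_1,s_2\rangle$ with longest element $w_0$. **Minors and operators.** For $X\in\mathfrak{g}$ put $(X^\dagger f)(x)=\frac{d}{dt}f(x\exp(tX))|_{t=0}$. For $x=[x]_-[x]_0[x]_+\in N^-HN^+$ set $\Delta^{\omega_i}(x)=[x]_0^{\omega_i}$ (it extends to a regular function on $G$). Let $\varphi_i:SL_2(\mathbb{C})\to G$ send $\begin{pmatrix}1&t\\0&1\end{pmatrix}\mapsto x_i(t)$, $\begin{pmatrix}1&0\\t&1\end{pmatrix}\mapsto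 y_i(t)$; $\overline{s_i}=\varphi_i\begin{pmatrix}0&-1\\1&0\end{pmatrix}$ and $\overline{w}=\overline{s_{i_1}}\cdots\overline{s_{i_l}}$ for a reduced word of $w$. Put $\Delta^{w\omega_i}(x)=\Delta^{\omega_i}(x\overline{w})$. Further define $F(2,1)=\frac13 f_1^\dagger\Delta^{s_2\omega_2}$, $F(1,1)=\frac12 f_1^\dagger F(2,1)=\frac16(f_1^\dagger)^2\Delta^{s_2\omega_2}$, $F(1,0)=f_2^\dagger F(1,1)$, $F^1(0,0)=(2f_1^\dagger f_2^\dagger-f_2^\dagger f_1^\dagger)F(1,1)$. **Seeds and mutation.** A seed consists of functions $x_k$ (mutable indices $1,2,3$, frozen indices $-1,-2,-3$) and an integer matrix $(b_{kl})$ with rows indexed by all indices and columns by mutable ones. Mutation $\mu_k$ at mutable $k$ replaces $x_k$ by $x_k'$ with $x_kx_k'=\prod_i x_i^{[b_{ik}]_+}+\prod_i x_i^{[-b_{ik}]_+}$ ($[b]_+=\max(0,b)$), and the matrix by $b'_{ij}=-b_{ij}$ if $i=k$ or $j=k$, and $b'_{ij}=b_{ij}+\mathrm{sgn}(b_{ik})[b_{ik}b_{kj}]_+$ otherwise. Each row of a matrix is listed below as (column 1, column 2, column 3). **Seed $\underline{\Sigma_2}$.** Matrix rows: $1:(0,-1,1)$; $2:(3,0,-3)$; $3:(-1,1,0)$; $-1:(1,0,0)$; $-2:(-3,1,0)$; $-3:(0,-1,2)$. Functions: $Y_{-1}=\Delta^{w_0\omega_2}$, $Y_{-2}=F^1(0,0)$,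 $Y_{-3}=\Delta^{\omega_2}$, $Y_1=\Delta^{s_1s_2s_1s_2\omega_2}$, $Y_2=F(1,1)$, $Y_3=\Delta^{s_1s_2\omega_2}$. **Seed $\Sigma_2^{(GLS)}$** (from Geiss–Leclerc–Schröer). Matrix rows: $1:(0,-1,1)$; $2:(3,0,-3)$; $3:(-1,1,0)$; $-1:(1,0,0)$; $-2:(-3,1,0)$; $-3:(0,0,1)$. Functions: $Y_{-1}^{(GLS)}=\Delta^{w_0\omega_2}$, $Y_{-2}^{(GLS)}=F^1(0,0)$, $Y_{-3}^{(GLS)}=\Delta^{\omega_2}$, $Y_1^{(GLS)}=F(2,1)F(1,0)-\Delta^{s_2\omega_2}F^1(0,0)$, $Y_2^{(GLS)}=F(2,1)$, $Y_3^{(GLS)}=\Delta^{s_2\omega_2}$. *)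

(* Defs.v *)
From HB Require Import structures.
From mathcomp Require Import all_boot all_order all_algebra.
From mathcomp Require Import complex fraction.
From mathcomp Require Import boolp classical_sets functions reals topology.
From mathcomp Require Import normedtype sequences derive.
Import numFieldNormedType.Exports.

Set Implicit Arguments.
Unset Strict Implicit.
Unset Printing Implicit Defensive.

Import Order.TTheory GRing.Theory Num.Theory.

Local Open Scope ring_scope.
Local Open Scope classical_set_scope.

(* Everything up to the seeds is developed over a numFieldType K, which carries
   both its algebra and its topology; K = R[i] with R : realType is the field
   of complex numbers. *)

Definition expm (K : numFieldType) (n : nat) (X : 'M[K]_n) : 'M[K]_n :=
  limn (series (fun k => (k`!)%:R^-1 *: X ^+ k)).

Definition comm (K : numFieldType) (n : nat) (X Y : 'M[K]_n) : 'M[K]_n :=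
  X * Y - Y * X.

(* r1 is the short simple root, r2 the long one. *)
Definition r1 : 'I_2 := ord0.
Definition r2 : 'I_2 := ord_max.

(* cartan i j = <alpha_i^vee, alpha_j> = alpha_j(h_i). *)
Definition cartan (i j : 'I_2) : int :=
  nth 0 (nth [::] [:: [:: 2; -3]; [:: -1; 2]] i) j.

Lemma cartan_diag i : cartan i i = 2.
Proof. by case: i => [[|[|[]]]]. Qed.

(* A nonzero n-dimensional matrix representation of the Lie algebra of type G2,
   given on Chevalley generators by the Chevalley-Serre presentation.  The Lie
   algebra being simple, the representation is faithful; its exponentials
   generate the simple algebraic group of type G2, which, being simply
   connected and of adjoint type, does not depend on the representation. *)
Record G2_rep (K : numFieldType) (n : nat) := MkG2Rep {
  che : 'I_2 -> 'M[K]_n;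
  chf : 'I_2 -> 'M[K]_n;
  chh : 'I_2 -> 'M[K]_n;
  che_neq0 : forall i, che i != 0;
  comm_hh : forall i j, comm (chh i) (chh j) = 0;
  comm_he : forall i j, comm (chh i) (che j) = che j *~ cartan i j;
  comm_hf : forall i j, comm (chh i) (chf j) = chf j *~ (- cartan i j);
  comm_ef : forall i j, comm (che i) (chf j) = if i == j then chh i else 0;
  serre_e : forall i j, i != j ->
    iter `|1 - cartan i j|%N (comm (che i)) (che j) = 0;
  serre_f : forall i j, i != j ->
    iter `|1 - cartan i j|%N (comm (chf i)) (chf j) = 0 }.

Section Exponential.
Variables (K : numFieldType) (n : nat).
Implicit Types h X : 'M[K]_n.

Lemma comm_expr h X c k :
  comm h X = c *: X -> comm h (X ^+ k) = (k%:R * c) *: X ^+ k.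
Proof.
move=> hX; elim: k => [|k IHk];
  first by rewrite /comm mulr1 mul1r subrr mul0r scale0r.
have -> : comm h (X ^+ k.+1) = comm h (X ^+ k) * X + X ^+ k * comm h X.
  by rewrite /comm exprSr mulrBl mulrBr !mulrA addrA subrK.
rewrite IHk hX -!mulmxE -scalemxAl -scalemxAr mulmxE -exprSr -scalerDl.
by rewrite -natr1 mulrDl mul1r.
Qed.

Lemma comm_nilpotent h X c :
  c != 0 -> comm h X = c *: X -> exists N, X ^+ N = 0.
Proof.
move=> c0 hX; apply: contrapT => /forallNP Xn0.
pose g := lin_mx (mulmx h) - lin_mx (mulmxr h) : 'M[K]_(n * n).
pose rs := [seq k%:R * c | k <- iota 0 (n * n).+1].
have : (size rs < size (char_poly g))%N.
  apply: max_poly_roots.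
  - by rewrite monic_neq0 // char_poly_monic.
  - apply/allP => _ /mapP[k _ ->]; rewrite -eigenvalue_root_char.
    apply/eigenvalueP; exists (mxvec (X ^+ k)).
      rewrite mulmxBr !mul_vec_lin /= -linearB -linearZ /=; congr mxvec.
      exact: comm_expr.
    apply/eqP => /(congr1 vec_mx); rewrite mxvecK linear0.
    exact: Xn0.
  - rewrite map_inj_uniq ?iota_uniq // => a b /(mulIf c0) /eqP.
    by rewrite eqr_nat => /eqP.
by rewrite size_map size_iota size_char_poly ltnn.
Qed.

Lemma expm_nilpotent X N :
  X ^+ N = 0 -> expm X = \sum_(k < N) (k`!)%:R^-1 *: X ^+ k.
Proof.
move=> XN; rewrite /expm; apply: lim_near_cst; first exact: norm_hausdorff.
exists N => // m /= Nm; rewrite /series /= (big_cat_nat (leq0n N) Nm) //=.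
rewrite [X in X + _]big_mkord [X in _ + X]big_nat.
rewrite [X in _ + X]big1 ?addr0 // => k /andP[Nk _].
by rewrite -(subnKC Nk) exprD XN mul0r scaler0.
Qed.

Lemma expm0 : expm (0 : 'M[K]_n) = 1.
Proof.
rewrite (@expm_nilpotent _ 1) ?expr1 //.
by rewrite big_ord1 fact0 invr1 scale1r expr0.
Qed.

Lemma scalemx_exp (t : K) X k : (t *: X) ^+ k = t ^+ k *: X ^+ k.
Proof.
elim: k => [|k IHk]; first by rewrite !expr0 scale1r.
by rewrite !exprS IHk -!mulmxE -scalemxAl -scalemxAr scalerA.
Qed.

Lemma expm_horner X N : X ^+ N = 0 ->
  exists P : 'I_n -> 'I_n -> {poly K},
    forall t i j, expm (t *: X) i j = (P i j).[t].
Proof.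
move=> XN.
exists (fun i j => \poly_(k < N) ((k`!)%:R^-1 * (X ^+ k) i j)) => t i j.
have tXN : (t *: X) ^+ N = 0 by rewrite scalemx_exp XN scaler0.
rewrite (expm_nilpotent tXN) summxE horner_poly; apply: eq_bigr => k _.
by rewrite scalemx_exp !mxE mulrCA mulrC.
Qed.

End Exponential.

Inductive monoid_gen (K : numFieldType) (n : nat) (S : set 'M[K]_n) :
    set 'M[K]_n :=
| monoid_gen_in x : S x -> monoid_gen S x
| monoid_gen1 : monoid_gen S 1
| monoid_genM x y : monoid_gen S x -> monoid_gen S y -> monoid_gen S (x * y).

(* Polynomial functions of the matrix entries. *)
Inductive polyfun (K : numFieldType) (n : nat) : ('M[K]_n -> K) -> Prop :=
| polyfun_cst c : polyfun (fun=> c)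
| polyfun_coord i j : polyfun (fun x => x i j)
| polyfunD p q : polyfun p -> polyfun q -> polyfun (fun x => p x + q x)
| polyfunM p q : polyfun p -> polyfun q -> polyfun (fun x => p x * q x).

Section Group.
Variables (K : numFieldType) (n : nat) (D : G2_rep K n).

Definition xmx (i : 'I_2) (t : K) : 'M[K]_n := expm (t *: che D i).
Definition ymx (i : 'I_2) (t : K) : 'M[K]_n := expm (t *: chf D i).

(* The following monoids are groups, because the inverse of exp(tX) is
   exp(-tX). *)
Definition Nplus : set 'M[K]_n := monoid_gen [set g | exists i t, g = xmx i t].
Definition Nminus : set 'M[K]_n := monoid_gen [set g | exists i t, g = ymx i t].
Definition G2_set : set 'M[K]_n :=
  monoid_gen [set g | exists i t, g = xmx i t \/ g = ymx i t].

Definition G2_group : Type := {g : 'M[K]_n | G2_set g}.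

Definition G2_one : G2_group := exist _ 1 (monoid_gen1 _).

Definition G2_mul (g h : G2_group) : G2_group :=
  exist _ (sval g * sval h) (monoid_genM (svalP g) (svalP h)).

Lemma xmx_G2 i t : G2_set (xmx i t).
Proof. by apply: monoid_gen_in; exists i, t; left. Qed.

Lemma ymx_G2 i t : G2_set (ymx i t).
Proof. by apply: monoid_gen_in; exists i, t; right. Qed.

Definition xG (i : 'I_2) (t : K) : G2_group := exist _ _ (xmx_G2 i t).
Definition yG (i : 'I_2) (t : K) : G2_group := exist _ _ (ymx_G2 i t).

(* Regular functions on G: restrictions of polynomials in the matrix entries.
   The inverse of the determinant is not needed, as the group lies in SL_n. *)
Definition is_regular : pred (G2_group -> K) :=
  fun f => `[< exists2 p, polyfun p & forall g : G2_group, f g = p (sval g) >].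

Lemma is_regularP f :
  reflect (exists2 p, polyfun p & forall g : G2_group, f g = p (sval g))
          (f \in is_regular).
Proof. exact: asboolP. Qed.

Lemma is_regular_subring : subring_closed is_regular.
Proof.
split.
- by apply/is_regularP; exists (fun=> 1) => //; exact: polyfun_cst.
- move=> f g /is_regularP[p pp fp] /is_regularP[q pq gq]; apply/is_regularP.
  exists (fun x => p x + (-1) * q x).
    by apply: polyfunD => //; apply: polyfunM => //; exact: polyfun_cst.
  by move=> x; rewrite mulN1r -fp -gq.
- move=> f g /is_regularP[p pp fp] /is_regularP[q pq gq]; apply/is_regularP.
  exists (fun x => p x * q x); first exact: polyfunM.
  by move=> x; rewrite -fp -gq.
Qed.

Lemma is_regular_scale : GRing.scaler_closed is_regular.
Proof.
move=> c f /is_regularP[p pp fp]; apply/is_regularP.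
exists (fun x => c * p x); last by move=> x; rewrite -fp.
by apply: polyfunM => //; exact: polyfun_cst.
Qed.

HB.instance Definition _ :=
  GRing.isSubringClosed.Build _ is_regular is_regular_subring.
HB.instance Definition _ :=
  GRing.isScaleClosed.Build _ _ is_regular is_regular_scale.

Record regfun := RegFun {
  regfun_val :> G2_group -> K; _ : regfun_val \in is_regular }.

HB.instance Definition _ := [isSub for regfun_val].
HB.instance Definition _ := [Choice of regfun by <:].
HB.instance Definition _ := 
  GRing.SubChoice_isSubComPzRing.Build _ _ regfun is_regular_subring.
HB.instance Definition _ := [SubZmodule_isSubLmodule of regfun by <:].

Lemma regfun_eqP (f g : regfun) : (forall x, f x = g x) <-> f = g.
Proof. by split=> [fg|->//]; apply/val_inj/funext. Qed.

Lemma regfun_oner_neq0 : (1 : regfun) != 0.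
Proof.
apply/eqP => /regfun_eqP /(_ G2_one) /eqP.
by rewrite (_ : (1 : regfun) G2_one = 1) // oner_eq0.
Qed.

HB.instance Definition _ :=
  GRing.PzSemiRing_isNonZero.Build regfun regfun_oner_neq0.

(* C[G] is an integral domain: any x and y in G are joined by a curve in G along
   which regular functions restrict to polynomials in one variable. *)

Lemma che_horner i : exists P : 'I_n -> 'I_n -> {poly K},
  forall t k l, xmx i t k l = (P k l).[t].
Proof.
have hX : comm (chh D i) (che D i) = 2 *: che D i.
  by rewrite comm_he cartan_diag scaler_nat.
have [|N XN] := comm_nilpotent _ hX; first by rewrite pnatr_eq0.
exact: expm_horner XN.
Qed.

Lemma chf_horner i : exists P : 'I_n -> 'I_n -> {poly K},
  forall t k l, ymx i t k l = (P k l).[t].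
Proof.
have hX : comm (chh D i) (chf D i) = (- 2) *: chf D i.
  by rewrite comm_hf cartan_diag mulrNz scaleNr scaler_nat.
have [|N XN] := comm_nilpotent _ hX; first by rewrite oppr_eq0 pnatr_eq0.
exact: expm_horner XN.
Qed.

Lemma polyfun_sum m (F : 'I_m -> 'M[K]_n -> K) :
  (forall l, polyfun (F l)) -> polyfun (fun x => \sum_(l < m) F l x).
Proof.
elim: m F => [|m IHm] F pF.
  by under eq_fun do rewrite big_ord0; exact: polyfun_cst.
under eq_fun do rewrite big_ord_recr /=.
by apply: polyfunD => //; apply: IHm.
Qed.

Lemma polyfun_horner (P : 'I_n -> 'I_n -> {poly K}) (M : K -> 'M[K]_n) p :
  (forall t k l, M t k l = (P k l).[t]) -> polyfun p ->
  exists Q : 'M[K]_n -> {poly K},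
    (forall x t, p (x * M t) = (Q x).[t]) /\
    (forall k, polyfun (fun x => (Q x)`_k)).
Proof.
move=> MP; elim=> {p} [c|i j|p q _ [P1 [pP1 cP1]] _ [Q1 [qQ1 cQ1]]
                      |p q _ [P1 [pP1 cP1]] _ [Q1 [qQ1 cQ1]]].
- exists (fun=> c%:P); split=> [x t|k]; first by rewrite hornerC.
  by under eq_fun do rewrite coefC; exact: polyfun_cst.
- exists (fun x => \sum_(l < n) x i l *: P l j); split=> [x t|k].
    rewrite -mulmxE mxE horner_sum; apply: eq_bigr => l _.
    by rewrite hornerZ MP.
  under eq_fun do (rewrite coef_sum; under eq_bigr do rewrite coefZ).
  apply: polyfun_sum => l; apply: polyfunM; first exact: polyfun_coord.
  exact: polyfun_cst.
- exists (fun x => P1 x + Q1 x); split=> [x t|k].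
    by rewrite hornerD pP1 qQ1.
  by under eq_fun do rewrite coefD; exact: polyfunD.
- exists (fun x => P1 x * Q1 x); split=> [x t|k].
    by rewrite hornerM pP1 qQ1.
  under eq_fun do rewrite coefM.
  by apply: polyfun_sum => l; exact: polyfunM.
Qed.

Lemma G2_curve g : G2_set g ->
  exists (P : 'I_n -> 'I_n -> {poly K}) (M : K -> 'M[K]_n),
  [/\ forall t k l, M t k l = (P k l).[t], forall t, G2_set (M t),
      M 0 = 1 & M 1 = g].
Proof.
elim=> {g} [_ [i [t []]] ->||
            x y _ [P [M [MP GM M0 M1]]] _ [Q [N [NQ GN N0 N1]]]].
- have [P xP] := che_horner i.
  exists (fun k l => P k l \Po (t *: 'X)), (fun s => xmx i (s * t)).
  split=> [s k l|s||]; rewrite ?mul1r //.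
  3: by rewrite /xmx mul0r scale0r expm0.
    by rewrite xP horner_comp hornerZ hornerX mulrC.
  exact: xmx_G2.
- have [P yP] := chf_horner i.
  exists (fun k l => P k l \Po (t *: 'X)), (fun s => ymx i (s * t)).
  split=> [s k l|s||]; rewrite ?mul1r //.
  3: by rewrite /ymx mul0r scale0r expm0.
    by rewrite yP horner_comp hornerZ hornerX mulrC.
  exact: ymx_G2.
- exists (fun k l => ((1 : 'M[K]_n) k l)%:P), (fun=> 1); split=> // [t k l|t].
    by rewrite hornerC.
  exact: monoid_gen1.
- exists (fun k l => \sum_(j < n) P k j * Q j l), (fun t => M t * N t).
  split=> [t k l|t||]; last 2 first.
    by rewrite M0 N0 mul1r.
    by rewrite M1 N1.
    2: exact: monoid_genM (GM t) (GN t).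
  rewrite -mulmxE mxE horner_sum; apply: eq_bigr => j _.
  by rewrite hornerM MP NQ.
Qed.

Lemma G2_joined x y : G2_set x -> G2_set y ->
  exists (P : 'I_n -> 'I_n -> {poly K}) (M : K -> 'M[K]_n),
  [/\ forall t k l, M t k l = (P k l).[t], forall t, G2_set (M t),
      M 0 = x & M 1 = y].
Proof.
move=> /G2_curve[P [M [MP GM M0 M1]]] /G2_curve[Q [N [NQ GN N0 N1]]].
exists (fun k l => \sum_(j < n) (P k j \Po (1 - 'X)) * Q j l).
exists (fun t => M (1 - t) * N t).
split=> [t k l|t||]; rewrite ?subr0 ?subrr ?M0 ?N0 ?M1 ?N1 ?mul1r ?mulr1 //.
  rewrite -mulmxE mxE horner_sum; apply: eq_bigr => j _.
  by rewrite hornerM MP NQ horner_comp hornerD hornerN hornerX hornerC.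
exact: monoid_genM (GM _) (GN _).
Qed.

Lemma horner_eq0 (p : {poly K}) : (forall t, p.[t] = 0) -> p = 0.
Proof.
move=> p0; apply: contrapT => /eqP pn0.
suff : (size [seq k%:R : K | k <- iota 0 (size p)] < size p)%N.
  by rewrite size_map size_iota ltnn.
apply: max_poly_roots => //; first by apply/allP => x _; apply/eqP/p0.
rewrite map_inj_uniq ?iota_uniq // => a b /eqP.
by rewrite eqr_nat => /eqP.
Qed.

Lemma regfun_mulf_eq0 (f g : regfun) : f * g = 0 -> (f == 0) || (g == 0).
Proof.
move=> fg0; apply: contrapT => /negP; rewrite negb_or => /andP[f0 g0].
have neq0 (h : regfun) : h != 0 -> exists x, h x != 0.
  move=> h0; apply: contrapT => /forallNP hx; move/eqP: h0; apply.
  by apply/regfun_eqP => x; apply/eqP; apply: contrapT => /negP; exact: hx.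
have [x fx] := neq0 f f0; have [y gy] := neq0 g g0.
have [p pp fp] := is_regularP _ (valP f).
have [q pq gq] := is_regularP _ (valP g).
have [P [M [MP GM Mx My]]] := G2_joined (svalP x) (svalP y).
have [P1 [pP1 _]] := polyfun_horner MP pp.
have [Q1 [qQ1 _]] := polyfun_horner MP pq.
have PQ0 : P1 1 * Q1 1 = 0.
  apply: horner_eq0 => t; rewrite hornerM -pP1 -qQ1 !mul1r.
  rewrite -(fp (exist _ _ (GM t))) -(gq (exist _ _ (GM t))).
  exact: ((regfun_eqP _ _).2 fg0 (exist _ _ (GM t))).
move/eqP: PQ0; rewrite mulf_eq0 => /orP[] /eqP PQ0.
- by move/eqP: fx; apply; rewrite fp -Mx -[M 0]mul1r pP1 PQ0 horner0.
- by move/eqP: gy; apply; rewrite gq -My -[M 1]mul1r qQ1 PQ0 horner0.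
Qed.

Definition regfun_unit : {pred regfun} :=
  fun f => `[< exists g : regfun, g * f = 1 >].

Definition regfun_inv (f : regfun) : regfun :=
  if pselect (exists g : regfun, g * f = 1) is left gf then sval (cid gf)
  else f.

Lemma regfun_mulVf : {in regfun_unit, left_inverse 1 regfun_inv *%R}.
Proof.
by move=> f /asboolP uf; rewrite /regfun_inv; case: pselect => // gf; case: cid.
Qed.

Lemma regfun_unitP (f g : regfun) : g * f = 1 -> regfun_unit f.
Proof. by move=> gf; apply/asboolP; exists g. Qed.

Lemma regfun_inv_out : {in [predC regfun_unit], regfun_inv =1 id}.
Proof.
by move=> f /asboolPn uf; rewrite /regfun_inv; case: pselect.
Qed.

HB.instance Definition _ := GRing.ComNzRing_hasMulInverse.Build regfun
  regfun_mulVf regfun_unitP regfun_inv_out.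
HB.instance Definition _ :=
  GRing.ComUnitRing_isIntegral.Build regfun regfun_mulf_eq0.

(* Right translation f |-> f(- g) on C[G]. *)
Lemma rtrans_regular (g : G2_group) (f : regfun) :
  (fun x => f (G2_mul x g)) \in is_regular.
Proof.
have [p pp fp] := is_regularP _ (valP f).
have MP t k l : (fun=> sval g) t k l = (sval g k l)%:P.[t] by rewrite hornerC.
have [Q [pQ cQ]] := polyfun_horner MP pp.
apply/is_regularP; exists (fun x => (Q x).[0]) => [|x]; last by rewrite fp -pQ.
by under eq_fun do rewrite horner_coef0; exact: cQ.
Qed.

Definition rtrans (g : G2_group) (f : regfun) : regfun :=
  RegFun (rtrans_regular g f).

Lemma is_derive_horner (p : {poly K}) (x : K) :
  is_derive x 1 (horner p) p^`().[x].
Proof.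
elim/poly_ind: p => [|p c IHp].
  rewrite deriv0 horner0 (_ : horner 0 = cst 0); first exact: is_derive_cst.
  by apply/funext => y; rewrite horner0.
rewrite (_ : horner (p * 'X + c%:P) = horner p * id + cst c); last first.
  by apply/funext => y; rewrite !hornerE.
apply: is_derive_eq.
rewrite derivMXaddC hornerD hornerM hornerX addr0.
by rewrite /GRing.scale /= mulr1 mulrC.
Qed.

(* The operator f_i^dagger on C[G]. *)
Lemma fdag_regular (i : 'I_2) (f : regfun) :
  (fun x => (fun t => f (G2_mul x (yG i t)))^`() 0) \in is_regular.
Proof.
have [p pp fp] := is_regularP _ (valP f).
have [P yP] := chf_horner i.
have [Q [pQ cQ]] := polyfun_horner yP pp.
apply/is_regularP; exists (fun x => (Q x)`_1) => [|x]; first exact: cQ.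
rewrite (_ : (fun t => _) = horner (Q (sval x))); last first.
  by apply/funext => t; rewrite fp -pQ.
rewrite derive1E (@derive_val _ _ _ _ _ _ _ (is_derive_horner _ _)).
by rewrite horner_coef0 coef_deriv mulr1n.
Qed.

Definition fdag (i : 'I_2) (f : regfun) : regfun := RegFun (fdag_regular i f).

Definition mx2 (a b c d : K) : 'M[K]_2 :=
  \matrix_(i, j) nth 0 (nth [::] [:: [:: a; b]; [:: c; d]] i) j.

(* phi restricts to the homomorphism from SL_2 to G attached to the index i; its
   values off SL_2 are irrelevant. *)
Definition is_SL2_hom (i : 'I_2) (phi : 'M[K]_2 -> G2_group) : Prop :=
  [/\ forall A B, \det A = 1 -> \det B = 1 ->
        phi (A * B) = G2_mul (phi A) (phi B),
      forall t, phi (mx2 1 t 0 1) = xG i t &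
      forall t, phi (mx2 1 0 t 1) = yG i t].

Section Minors.
Variable phi : 'I_2 -> 'M[K]_2 -> G2_group.

Definition sbar (i : 'I_2) : G2_group := phi i (mx2 0 (-1) 1 0).

(* The word s is meant to be reduced. *)
Definition wbar (s : seq 'I_2) : G2_group :=
  foldr (fun i g => G2_mul (sbar i) g) G2_one s.

(* G being simply connected, this parametrizes the maximal torus H by the
   values h^(omega_i) = a i of the fundamental weights. *)
Definition torus (a : 'I_2 -> K) : G2_group :=
  G2_mul (phi r1 (mx2 (a r1) 0 0 (a r1)^-1))
         (phi r2 (mx2 (a r2) 0 0 (a r2)^-1)).

(* Delta is Delta^(omega_i); it is unique, as N^- H N^+ is dense in G. *)
Definition is_principal_minor (i : 'I_2) (Delta : regfun) : Prop :=
  forall (u v : G2_group) (a : 'I_2 -> K),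
    Nminus (sval u) -> Nplus (sval v) -> (forall j, a j != 0) ->
    Delta (G2_mul (G2_mul u (torus a)) v) = a i.

Variable Delta2 : regfun.

(* Delta^(w omega_2), for w the product of the simple reflections in s. *)
Definition minor2 (s : seq 'I_2) : regfun := rtrans (wbar s) Delta2.

Definition F21 : regfun := 3^-1 *: fdag r1 (minor2 [:: r2]).
Definition F11 : regfun := 2^-1 *: fdag r1 F21.
Definition F10 : regfun := fdag r2 F11.
Definition F00 : regfun :=
  2 *: fdag r1 (fdag r2 F11) - fdag r2 (fdag r1 F11).

End Minors.

End Group.

(* inl k is the mutable index k + 1 and inr k is the frozen index - (k + 1). *)
Definition seed_index : Type := ('I_3 + 'I_3)%type.

Record seed (F : fieldType) := Seed {
  seed_var : seed_index -> F;
  seed_mx : seed_index -> 'I_3 -> int }.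

Definition mutate (F : fieldType) (k : 'I_3) (S : seed F) : seed F :=
  let x := seed_var S in
  let b := seed_mx S in
  Seed
    (fun i => if i == inl k then
       (\prod_(j : 'I_3 + 'I_3) x j ^ Num.max 0 (b j k) +
        \prod_(j : 'I_3 + 'I_3) x j ^ Num.max 0 (- b j k)) / x (inl k)
     else x i)
    (fun i j => if (i == inl k) || (j == k) then - b i j
     else b i j + Num.sg (b i k) * Num.max 0 (b i k * b (inl k) j)).

Definition m1 : 'I_3 := @Ordinal 3 0 isT.
Definition m2 : 'I_3 := @Ordinal 3 1 isT.
Definition m3 : 'I_3 := @Ordinal 3 2 isT.

(* The seed with mutable variables xm, frozen variables xf (in the order
   -1, -2, -3), and matrix with mutable rows bm and frozen rows bf. *)
Definition seed_of (F : fieldType) (xm xf : seq F) (bm bf : seq (seq int)) :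
    seed F :=
  Seed (fun i => match i with inl k => xm`_k | inr k => xf`_k end)
       (fun i j => match i with
                   | inl k => (nth [::] bm k)`_j
                   | inr k => (nth [::] bf k)`_j
                   end).

Section Seeds.
Variables (K : numFieldType) (n : nat) (D : G2_rep K n).
Variable phi : 'I_2 -> 'M[K]_2 -> G2_group D.
Variable Delta2 : regfun D.

Local Notation Delta := (minor2 phi Delta2).
Local Notation F21 := (F21 phi Delta2).
Local Notation F11 := (F11 phi Delta2).
Local Notation F10 := (F10 phi Delta2).
Local Notation F00 := (F00 phi Delta2).
Local Notation "x %:F" := (@FracField.tofrac (regfun D) x).

(* The reduced word of the longest element w_0. *)
Definition w0 : seq 'I_2 := [:: r1; r2; r1; r2; r1; r2].

Definition Sigma2 : seed {fraction regfun D} :=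
  seed_of
    [:: (Delta [:: r1; r2; r1; r2])%:F; F11%:F; (Delta [:: r1; r2])%:F]
    [:: (Delta w0)%:F; F00%:F; Delta2%:F]
    [:: [:: 0; -1; 1]; [:: 3; 0; -3]; [:: -1; 1; 0]]
    [:: [:: 1; 0; 0]; [:: -3; 1; 0]; [:: 0; -1; 2]].

Definition Sigma2_GLS : seed {fraction regfun D} :=
  seed_of
    [:: (F21 * F10 - Delta [:: r2] * F00)%:F; F21%:F; (Delta [:: r2])%:F]
    [:: (Delta w0)%:F; F00%:F; Delta2%:F]
    [:: [:: 0; -1; 1]; [:: 3; 0; -3]; [:: -1; 1; 0]]
    [:: [:: 1; 0; 0]; [:: -3; 1; 0]; [:: 0; 0; 1]].

End Seeds.

(* Main.v *)
(* Right translation makes C[G] a module over the Lie algebra by derivations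
   e_i, f_i, h_i, and a function is determined by the values at 1 of its images
   under all words in the e_i and f_i.  Moving the f_i to the left of such words
   and the e_i to the right shows that the big cell N^- H N^+ is dense, so that
   Delta^(omega_2) is a left N^- invariant vector annihilated by e_1 and e_2, of
   weight omega_2.  A left N^- invariant weight vector that vanishes at 1 and is
   annihilated by the e_i is zero; this gives the structure of the
   14-dimensional module generated by Delta^(omega_2), and the quadratic relation
     Delta^(s_2 omega_2) F(1,1) = F(1,0) Delta^(omega_2) + F(2,1)^2,
   a singular vector of weight 2 omega_1.  Applying the f_i to it produces the
   quadrics from which the remaining exchange relations follow. *)
From HB Require Import structures.
Require Import Defs.
From mathcomp Require Import all_boot all_order all_algebra.
From mathcomp Require Import complex fraction.
From mathcomp Require Import boolp classical_sets functions reals topology.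
From mathcomp Require Import normedtype derive.
From mathcomp Require Import ring.
Import numFieldNormedType.Exports.

Set Implicit Arguments.
Unset Strict Implicit.
Unset Printing Implicit Defensive.

Import Order.TTheory GRing.Theory Num.Theory.
Local Open Scope ring_scope.

(** * Polynomial functions along curves of matrices *)

(** Comparing the matrices is a computation; the content is that mu_3 produces in both seeds the
    same variable f = F(1,1) F(2,1) - F^1(0,0) Delta^(omega_2). The exchange relation for mu_2 is
    then the definition of f, and cubic relations remain to be proved for the two mu_3 and for mu_1;
    the clusters agree index by index. Two obstacles shape the proof. Delta^(omega_2) is known only
    through its values on the big cell, and the group only through generating exponentials, so
    density is obtained by differentiation instead of dimension or orbit arguments. And the torus is
    not given by exponentials: a curve in it comes from factoring a diagonal matrix of SL_2 into
    root elements. The minors enter the module because the lift of s_i sends the top of a string of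
    length m to its bottom by f_i^m / m!; along the reduced words all minors are therefore extremal
    vectors. *)

Section MatrixCurves.
Variables (K : numFieldType) (n : nat).
Implicit Types (M L : K -> 'M[K]_n) (V W X Y : 'M[K]_n) (p q : 'M[K]_n -> K).

Definition mx_derive0 M V :=
  forall i j, is_derive (0 : K) 1 (fun s => M s i j) (V i j).

Lemma mx_derive0_cst X : mx_derive0 (fun=> X) 0.
Proof. by move=> i j; rewrite mxE; exact: is_derive_cst. Qed.

Lemma mx_derive0M M L V W : mx_derive0 M V -> mx_derive0 L W ->
  mx_derive0 (fun s => M s * L s) (V * L 0 + M 0 * W).
Proof.
move=> MV NW i j.
have -> : (fun s => (M s * L s) i j) =
    \sum_(k < n) ((fun s => M s i k) * (fun s => L s k j)).
  by apply/funext => s; rewrite -mulmxE mxE fct_sumE.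
rewrite -!mulmxE !mxE -big_split /=.
apply: is_derive_sum => k.
have := is_deriveM (MV i k) (NW k j).
by move/is_derive_eq; apply; rewrite addrC; congr (_ + _); exact: mulrC.
Qed.

(** The parameter is a function [u] because the torus curve passes through root subgroups at
    parameter s / (1 + s). As [X] is nilpotent, the exponential is a polynomial in [u s], and
    [u 0 = 0] leaves only its linear coefficient. *)
Lemma mx_derive0_expm (u : K -> K) (du : K) X (N : nat) :
  X ^+ N = 0 -> u 0 = 0 ->
  is_derive (0 : K) 1 u du ->
  mx_derive0 (fun s => expm (u s *: X)) (du *: X).
Proof.
move=> XN u0 hu i j.
(* Two extra terms keep the linear coefficient inside the truncation even when [N] is 0 or 1. *)
have XN2 : X ^+ N.+2 = 0 by rewrite !exprS XN !mulr0.
have comp (P : {poly K}) : is_derive (0 : K) 1 (fun s => P.[u s]) (P`_1 * du).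
  suff /(_ P) : forall P : {poly K},
      is_derive (0 : K) 1 (fun s => P.[u s]) (P^`().[u 0] * du).
    by rewrite u0 horner_coef0 coef_deriv.
  elim/poly_ind => [|{}P c IHP].
    rewrite deriv0 horner0 mul0r (_ : (fun _ => _) = cst 0).
      exact: is_derive_cst.
    by apply/funext => s; rewrite horner0.
  rewrite (_ : (fun _ => _) = (fun s => P.[u s]) * u + cst c); last first.
    by apply/funext => s; rewrite !hornerE.
  have := is_deriveD (is_deriveM IHP hu)
    (is_derive_cst (c : K) (0 : K) (1 : K)).
  move/is_derive_eq; apply.
  rewrite derivMXaddC !hornerE /GRing.scale /=; ring.
pose P := \poly_(k < N.+2) ((k`!)%:R^-1 * (X ^+ k) i j).
have -> : (fun s => expm (u s *: X) i j) = (fun s => P.[u s]).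
  apply/funext => s.
  have tXN : (u s *: X) ^+ N.+2 = 0 by rewrite scalemx_exp XN2 scaler0.
  rewrite (expm_nilpotent tXN) summxE horner_poly; apply: eq_bigr => k _.
  by rewrite scalemx_exp !mxE mulrCA mulrC.
have := comp P; rewrite coef_poly /= (_ : 1`! = 1%N) // invr1 mul1r expr1 mxE.
by rewrite mulrC.
Qed.

(** Chain rule: the derivative depends on the curve only through its point and velocity at 0, so
    curves with the same velocity are interchangeable. *)
Lemma polyfun_differential p : polyfun p ->
  exists dp : 'M[K]_n -> 'M[K]_n -> K, forall M V,
    mx_derive0 M V -> is_derive (0 : K) 1 (p \o M) (dp (M 0) V).
Proof.
elim=> {p} [c|i j|p q _ [dp dpP] _ [dq dqP]|p q _ [dp dpP] _ [dq dqP]].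
- by exists (fun _ _ => 0) => M V _; exact: is_derive_cst.
- by exists (fun _ V => V i j) => M V; apply.
- exists (fun x V => dp x V + dq x V) => M V MV.
  exact: is_deriveD (dpP _ _ MV) (dqP _ _ MV).
- exists (fun x V => p x * dq x V + q x * dp x V) => M V MV.
  exact: is_deriveM (dpP _ _ MV) (dqP _ _ MV).
Qed.

(** The line x (1 + s X) has the velocity of x exp(s X) but may leave the group. It gives a
    derivation for every matrix [X], nilpotent or not, so that [chh D i] is treated like the root
    vectors. *)
Definition mx_dag X p x : K := (fun s => p (x * (1 + s *: X)))^`()%classic 0.

Lemma mx_derive0_line x X : mx_derive0 (fun s => x * (1 + s *: X)) (x * X).
Proof.
move=> i j.
rewrite (_ : (fun _ => _) = cst (x i j) + (x * X) i j \*: id).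
  have := is_deriveD (is_derive_cst (x i j : K) (0 : K) (1 : K))
    (is_deriveZ ((x * X) i j) (is_derive_id (0 : K) (1 : K))).
  by move/is_derive_eq; apply; rewrite add0r /GRing.scale /= mulr1.
apply/funext => s; rewrite mulrDr mulr1 -mulmxE -scalemxAr !mxE /=.
by rewrite mulrC.
Qed.

Lemma mx_line0 x X : x * (1 + 0 *: X) = x.
Proof. by rewrite scale0r addr0 mulr1. Qed.

Lemma is_derive_mx_dag X p M x : polyfun p -> M 0 = x ->
  mx_derive0 M (x * X) -> is_derive (0 : K) 1 (p \o M) (mx_dag X p x).
Proof.
move=> /polyfun_differential[dp dpP] M0 MX.
have := dpP _ _ MX; rewrite M0 => /is_derive_eq; apply.
rewrite /mx_dag derive1E.
have := dpP _ _ (mx_derive0_line x X); rewrite scale0r addr0 mulr1 => h.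
exact: (esym (@derive_val _ _ _ _ _ _ _ h)).
Qed.

Lemma mx_dagE X p M x : polyfun p -> M 0 = x -> mx_derive0 M (x * X) ->
  (p \o M)^`()%classic 0 = mx_dag X p x.
Proof.
move=> pp M0 MX; rewrite derive1E.
exact: (@derive_val _ _ _ _ _ _ _ (is_derive_mx_dag pp M0 MX)).
Qed.

Lemma mx_dag_cst X c : mx_dag X (fun=> c) = fun=> 0.
Proof.
apply/funext => x; rewrite /mx_dag derive1E.
exact: (@derive_val _ _ _ _ _ _ _ (is_derive_cst (c : K) (0 : K) (1 : K))).
Qed.

Lemma is_derive_mx_line X p x : polyfun p ->
  is_derive (0 : K) 1 (fun s => p (x * (1 + s *: X))) (mx_dag X p x).
Proof.
move=> pp.
exact: (is_derive_mx_dag pp (mx_line0 x X) (mx_derive0_line x X)).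
Qed.

Lemma mx_dag_coord X i j : mx_dag X (fun x => x i j) = fun x => (x * X) i j.
Proof.
apply/funext => x; rewrite /mx_dag derive1E.
exact: (@derive_val _ _ _ _ _ _ _ (mx_derive0_line x X i j)).
Qed.

Lemma mx_dagD X p q : polyfun p -> polyfun q ->
  mx_dag X (fun x => p x + q x) = fun x => mx_dag X p x + mx_dag X q x.
Proof.
move=> pp pq; apply/funext => x; rewrite {1}/mx_dag derive1E.
exact: (@derive_val _ _ _ _ _ _ _
  (is_deriveD (is_derive_mx_line X x pp) (is_derive_mx_line X x pq))).
Qed.

Lemma mx_dagM X p q : polyfun p -> polyfun q ->
  mx_dag X (fun x => p x * q x) =
  fun x => mx_dag X p x * q x + p x * mx_dag X q x.
Proof.
move=> pp pq; apply/funext => x; rewrite {1}/mx_dag derive1E.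
have := @derive_val _ _ _ _ _ _ _
  (is_deriveM (is_derive_mx_line X x pp) (is_derive_mx_line X x pq)).
by move=> h; rewrite [LHS]h !mx_line0 addrC mulrC.
Qed.

Lemma polyfun_mx_dag X p : polyfun p -> polyfun (mx_dag X p).
Proof.
elim=> {p} [c|i j|p q pp Dp pq Dq|p q pp Dp pq Dq].
- by rewrite mx_dag_cst; exact: polyfun_cst.
- rewrite mx_dag_coord.
  under eq_fun do rewrite -mulmxE mxE.
  apply: polyfun_sum => l; apply: polyfunM; first exact: polyfun_coord.
  exact: polyfun_cst.
- by rewrite mx_dagD //; exact: polyfunD.
- by rewrite mx_dagM //; apply: polyfunD; exact: polyfunM.
Qed.

Lemma mx_dag_scale X (c : K) p x :
  polyfun p -> mx_dag X (fun x => c * p x) x = c * mx_dag X p x.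
Proof.
move=> pp; rewrite mx_dagM //; last exact: polyfun_cst.
by rewrite mx_dag_cst mul0r add0r.
Qed.

Lemma mx_dag_linear (c : K) X Y p x : polyfun p ->
  mx_dag (c *: X + Y) p x = c * mx_dag X p x + mx_dag Y p x.
Proof.
move=> pp; elim: pp x => {p} [d|i j|p q pp IHp pq IHq|p q pp IHp pq IHq] x.
- by rewrite !mx_dag_cst mulr0 addr0.
- by rewrite !mx_dag_coord mulrDr -!mulmxE -scalemxAr !mxE.
- by rewrite !mx_dagD // IHp IHq; ring.
- by rewrite !mx_dagM // IHp IHq; ring.
Qed.

Lemma mx_dag0 p x : polyfun p -> mx_dag 0 p x = 0.
Proof.
move=> pp; have := mx_dag_linear (-1) 0 0 x pp.
by rewrite scaler0 addr0 mulN1r addNr.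
Qed.

(** A commutator of derivations is a derivation, so the coordinates decide; on them [mx_dag X] is
    right multiplication by [X]. *)
Lemma mx_dag_comm X Y p x : polyfun p ->
  mx_dag X (mx_dag Y p) x - mx_dag Y (mx_dag X p) x = mx_dag (comm X Y) p x.
Proof.
move=> pp; elim: pp x => {p} [d|i j|p q pp IHp pq IHq|p q pp IHp pq IHq] x.
- by rewrite !mx_dag_cst subrr.
- have dagXZ A B : mx_dag A (fun x => (x * B) i j) x = (x * A * B) i j.
    rewrite /mx_dag derive1E.
    have := mx_derive0M (mx_derive0_line x A) (mx_derive0_cst B) i j.
    rewrite mulr0 addr0 => h.
    exact: (@derive_val _ _ _ _ _ _ _ h).
  by rewrite !mx_dag_coord !dagXZ /comm mulrBr !mulrA !mxE.
- rewrite !mx_dagD //; try exact: polyfun_mx_dag.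
  rewrite -IHp -IHq.
  move: (mx_dag X (mx_dag Y p) x) (mx_dag Y (mx_dag X p) x) => a1 a2.
  move: (mx_dag X (mx_dag Y q) x) (mx_dag Y (mx_dag X q) x) => b1 b2.
  by ring.
- rewrite !mx_dagM // !mx_dagD; try (apply: polyfunM => //; exact:
    polyfun_mx_dag).
  rewrite !mx_dagM //; try exact: polyfun_mx_dag.
  rewrite -IHp -IHq.
  move: (mx_dag X (mx_dag Y p) x) (mx_dag Y (mx_dag X p) x) => a1 a2.
  move: (mx_dag X (mx_dag Y q) x) (mx_dag Y (mx_dag X q) x) => b1 b2.
  move: (mx_dag X p x) (mx_dag Y p x) (mx_dag X q x) (mx_dag Y q x) => *.
  by ring.
Qed.

End MatrixCurves.

(** * Conjugation by the exponential of a nilpotent matrix *)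

Section ExpConj.
Variables (K : numFieldType) (n : nat).
Implicit Types (X Y Z W : 'M[K]_n).

(** The formula exp(X) Y exp(-X) = exp(ad X) Y, cut off by (ad X)^3 Y = 0 and written without the
    inverse. *)
Lemma expm_conj X Y Z W (N : nat) : X ^+ N = 0 ->
  comm X Y = Z -> comm X Z = W -> comm X W = 0 ->
  expm X * Y = (Y + Z + 2^-1 *: W) * expm X.
Proof.
move=> XN XY XZ XW.
have {}XY : X * Y = Y * X + Z by rewrite -XY /comm addrC subrK.
have {}XZ : X * Z = Z * X + W by rewrite -XZ /comm addrC subrK.
have {}XW : X * W = W * X by apply/eqP; rewrite -subr_eq0; apply/eqP.
have XnW k : X ^+ k * W = W * X ^+ k.
  elim: k => [|k IHk]; first by rewrite expr0 mul1r mulr1.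
  by rewrite exprS -mulrA IHk mulrA XW -mulrA.
have XnZ k : X ^+ k.+1 * Z = Z * X ^+ k.+1 + k.+1%:R *: (W * X ^+ k).
  elim: k => [|k IHk]; first by rewrite expr1 expr0 mulr1 scale1r.
  rewrite exprS -mulrA IHk mulrDr mulrA XZ mulrDl -!mulrA -!exprS -addrA.
  congr (_ + _); rewrite -!mulmxE -scalemxAr !mulmxE mulrA XW -mulrA -exprS.
  by rewrite -[in RHS]natr1 scalerDl scale1r addrC.
(* The coefficients are the binomials of k + 2 over 0, 1 and 2. *)
have XnY k : X ^+ k.+2 * Y = Y * X ^+ k.+2 + k.+2%:R *: (Z * X ^+ k.+1) +
    (k.+2%:R * k.+1%:R / 2) *: (W * X ^+ k).
  elim: k => [|k IHk].
    rewrite expr2 expr1 expr0 mulr1 -mulrA XY mulrDr XZ mulrA XY mulrDl.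
    rewrite mulr1 divff ?pnatr_eq0 // scale1r -mulrA scaler_nat mulr2n.
    by rewrite -!addrA.
  have scl (c : K) (A B : 'M[K]_n) : A * (c *: B) = c *: (A * B).
    by rewrite -!mulmxE -scalemxAr.
  rewrite exprS -mulrA IHk -!(natr1 k.+2) -!(natr1 k.+1).
  move: (k.+1%:R : K) => c.
  rewrite !mulrDr !scl !mulrA XY XZ XW !mulrDl -!mulrA -!exprS.
  move: (Y * _) (Z * _) (W * _) => A B C.
  by apply/matrixP => i j; rewrite !mxE; field.
pose a k := (k`!)%:R^-1 *: X ^+ k : 'M[K]_n.
have XN2 : X ^+ N.+2 = 0 by rewrite !exprS XN !mulr0.
have expE M : (N <= M)%N -> expm X = \sum_(k < M) a k.
  by move=> NM; apply: expm_nilpotent; rewrite -(subnKC NM) exprD XN mul0r.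
rewrite [RHS]mulrDl [X in X + _]mulrDl -!mulmxE -scalemxAl !mulmxE.
(* The exponentials next to Y, Z and W are cut after N + 2, N + 1 and N terms, so that the index
   shifts in [aY] match term by term. *)
rewrite {1 2}(expE N.+2) ?leqW // {1}(expE N.+1) // (expE N) //.
rewrite mulr_suml !mulr_sumr scaler_sumr.
rewrite 2![in LHS]big_ord_recl [X in X + _ + _]big_ord_recl.
rewrite [X in _ + X + _ + _]big_ord_recl [X in _ + X + _]big_ord_recl /=.
have scl (c : K) (A B : 'M[K]_n) : c *: A * B = c *: (A * B).
  by rewrite -!mulmxE -scalemxAl.
have scr (c : K) (A B : 'M[K]_n) : A * (c *: B) = c *: (A * B).
  by rewrite -!mulmxE -scalemxAr.
have aY k : a k.+2 * Y = Y * a k.+2 + Z * a k.+1 + 2^-1 *: (W * a k).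
  rewrite /a !scr !scalerA scl XnY !scalerDr !scalerA.
  rewrite !factS !natrM.
  have : (k`!)%:R != 0 :> K by rewrite pnatr_eq0 -lt0n fact_gt0.
  have : k.+1%:R != 0 :> K by rewrite pnatr_eq0.
  have : k.+2%:R != 0 :> K by rewrite pnatr_eq0.
  move: (k.+2%:R : K) (k.+1%:R : K) ((k`!)%:R : K) => c2 c1 c0 c2n c1n c0n.
  by congr (_ + _ *: _ + _ *: _); field; rewrite ?c2n ?c1n ?c0n.
rewrite (eq_bigr _ (fun (i : 'I_N) _ => aY i)) !big_split /=.
have a0 : a 0%N = 1 by rewrite /a fact0 invr1 scale1r expr0.
have a1 : a 1%N = X by rewrite /a invr1 scale1r expr1.
rewrite -[bump 0 0]/1%N a0 a1 !mulr1 mul1r XY.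
move: (\sum_(i < N) _) (\sum_(i < N) _) (\sum_(i < N) _) => A B C.

by rewrite !addrA (addrAC _ Z C).
Qed.

End ExpConj.

(** * The action of the Lie algebra on C[G] *)

Section Operators.
Variables (K : numFieldType) (n : nat) (D : G2_rep K n).
Implicit Types (f g : regfun D) (x : G2_group D) (i j : 'I_2).

Lemma regfun_addE f g x : (f + g) x = f x + g x. Proof. by []. Qed.
Lemma regfun_oppE f x : (- f) x = - f x. Proof. by []. Qed.
Lemma regfun_mulE f g x : (f * g) x = f x * g x. Proof. by []. Qed.
Lemma regfun_scaleE (c : K) f x : (c *: f) x = c * f x. Proof. by []. Qed.

Lemma regfun_polyfun f : exists2 p, polyfun p & forall x, f x = p (sval x).
Proof. exact: is_regularP (valP f). Qed.

Lemma regfun_sval f x y : sval x = sval y -> f x = f y.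
Proof. by move=> xy; have [p _ fp] := regfun_polyfun f; rewrite !fp xy. Qed.

Lemma che_nilpotent i : exists N, che D i ^+ N = 0.
Proof.
apply: (@comm_nilpotent _ _ (chh D i) _ 2); first by rewrite pnatr_eq0.
by rewrite comm_he cartan_diag scaler_nat.
Qed.

Lemma chf_nilpotent i : exists N, chf D i ^+ N = 0.
Proof.
apply: (@comm_nilpotent _ _ (chh D i) _ (- 2)).
  by rewrite oppr_eq0 pnatr_eq0.
by rewrite comm_hf cartan_diag mulrNz scaleNr scaler_nat.
Qed.

Lemma mx_derive0_xmx (u : K -> K) du i : u 0 = 0 ->
  is_derive (0 : K) 1 u du ->
  mx_derive0 (fun s => xmx D i (u s)) (du *: che D i).
Proof. by have [N] := che_nilpotent i; exact: mx_derive0_expm. Qed.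

Lemma mx_derive0_ymx (u : K -> K) du i : u 0 = 0 ->
  is_derive (0 : K) 1 u du ->
  mx_derive0 (fun s => ymx D i (u s)) (du *: chf D i).
Proof. by have [N] := chf_nilpotent i; exact: mx_derive0_expm. Qed.

Lemma xmx0 i : xmx D i 0 = 1. Proof. by rewrite /xmx scale0r expm0. Qed.
Lemma ymx0 i : ymx D i 0 = 1. Proof. by rewrite /ymx scale0r expm0. Qed.

Lemma edag_regular i f :
  (fun x => (fun t => f (G2_mul x (xG D i t)))^`()%classic 0) \in @is_regular _
    _ D.
Proof.
have [p pp fp] := regfun_polyfun f.
apply/is_regularP; exists (mx_dag (che D i) p).
  exact: polyfun_mx_dag.
move=> x; rewrite -(@mx_dagE _ _ _ _ (fun t => sval x * xmx D i t)) //=.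
- by congr (_^`()%classic 0); apply/funext => t; rewrite fp.
- by rewrite xmx0 mulr1.
- have := mx_derive0M (mx_derive0_cst (sval x))
    (mx_derive0_xmx i erefl (is_derive_id (0 : K) (1 : K))).
  by rewrite mul0r add0r scale1r.
Qed.

Definition edag i f : regfun D := RegFun (edag_regular i f).

Lemma edagE i f p : polyfun p -> (forall x, f x = p (sval x)) ->
  forall x, edag i f x = mx_dag (che D i) p (sval x).
Proof.
move=> pp fp x; rewrite -(@mx_dagE _ _ _ _ (fun t => sval x * xmx D i t)) //=.
- by congr (_^`()%classic 0); apply/funext => t; rewrite fp.
- by rewrite xmx0 mulr1.
- have := mx_derive0M (mx_derive0_cst (sval x))
    (mx_derive0_xmx i erefl (is_derive_id (0 : K) (1 : K))).
  by rewrite mul0r add0r scale1r.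
Qed.

Lemma fdagE i f p : polyfun p -> (forall x, f x = p (sval x)) ->
  forall x, fdag i f x = mx_dag (chf D i) p (sval x).
Proof.
move=> pp fp x; rewrite -(@mx_dagE _ _ _ _ (fun t => sval x * ymx D i t)) //=.
- by congr (_^`()%classic 0); apply/funext => t; rewrite fp.
- by rewrite ymx0 mulr1.
- have := mx_derive0M (mx_derive0_cst (sval x))
    (mx_derive0_ymx i erefl (is_derive_id (0 : K) (1 : K))).
  by rewrite mul0r add0r scale1r.
Qed.

(** As a commutator it is regular by construction; [hdagE] identifies it with differentiation along
    [chh D i]. *)
Definition hdag i f : regfun D := edag i (fdag i f) - fdag i (edag i f).

Lemma ef_comm i j f p : polyfun p -> (forall x, f x = p (sval x)) ->
  forall x, edag i (fdag j f) x - fdag j (edag i f) x =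
    mx_dag (comm (che D i) (chf D j)) p (sval x).
Proof.
move=> pp fp x.
rewrite (edagE _ (polyfun_mx_dag _ pp) (fdagE j pp fp)).
rewrite (fdagE _ (polyfun_mx_dag _ pp) (edagE i pp fp)).
exact: mx_dag_comm.
Qed.

Lemma hdagE i f p : polyfun p -> (forall x, f x = p (sval x)) ->
  forall x, hdag i f x = mx_dag (chh D i) p (sval x).
Proof.
by move=> pp fp x; rewrite /hdag [LHS](ef_comm _ _ pp fp) comm_ef eqxx.
Qed.

Lemma edag_fdag i j f :
  edag i (fdag j f) = fdag j (edag i f) + (if i == j then hdag i f else 0).
Proof.
case: eqP => [<-|/eqP ij]; first by rewrite /hdag addrC subrK.
apply/regfun_eqP => x; rewrite addr0.
have [p pp fp] := regfun_polyfun f.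
apply/eqP; rewrite -subr_eq0 (ef_comm _ _ pp fp) comm_ef (negbTE ij).
by rewrite mx_dag0.
Qed.

Lemma mx_dag_mulrz (X : 'M[K]_n) (c : int) p (x : 'M[K]_n) :
  polyfun p -> mx_dag (X *~ c) p x = mx_dag X p x *~ c.
Proof.
move=> pp; rewrite -scaler_int -[_ *: X]addr0 mx_dag_linear //.
by rewrite mx_dag0 // addr0 mulrzl.
Qed.

Lemma regfun_mulrzE f (c : int) x : (f *~ c) x = f x *~ c.
Proof.
have mulrnE m : (f *+ m) x = f x *+ m.
  by elim: m => // m IHm; rewrite !mulrS regfun_addE IHm.
by case: c => m; rewrite ?NegzE ?mulrNz ?regfun_oppE -!pmulrn mulrnE.
Qed.

Lemma hdag_edag i j f :
  hdag i (edag j f) = edag j (hdag i f) + edag j f *~ cartan i j.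
Proof.
apply/regfun_eqP => x; have [p pp fp] := regfun_polyfun f.
rewrite regfun_addE regfun_mulrzE (edagE _ pp fp).
rewrite (hdagE _ (polyfun_mx_dag _ pp) (edagE j pp fp)).
rewrite (edagE _ (polyfun_mx_dag _ pp) (hdagE i pp fp)).
rewrite -mx_dag_mulrz // -comm_he -mx_dag_comm //.
by rewrite addrC subrK.
Qed.

Lemma hdag_fdag i j f :
  hdag i (fdag j f) = fdag j (hdag i f) - fdag j f *~ cartan i j.
Proof.
apply/regfun_eqP => x; have [p pp fp] := regfun_polyfun f.
rewrite regfun_addE regfun_oppE regfun_mulrzE (fdagE _ pp fp).
rewrite (hdagE _ (polyfun_mx_dag _ pp) (fdagE j pp fp)).
rewrite (fdagE _ (polyfun_mx_dag _ pp) (hdagE i pp fp)).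
rewrite -mulrNz -mx_dag_mulrz // -comm_hf -mx_dag_comm //.
by rewrite addrC subrK.
Qed.

Lemma hdag_comm i j f : hdag i (hdag j f) = hdag j (hdag i f).
Proof.
apply/regfun_eqP => x; have [p pp fp] := regfun_polyfun f.
rewrite (hdagE _ (polyfun_mx_dag _ pp) (hdagE j pp fp)).
rewrite (hdagE _ (polyfun_mx_dag _ pp) (hdagE i pp fp)).
by apply/eqP; rewrite -subr_eq0 mx_dag_comm // comm_hh mx_dag0.
Qed.

Definition derivation (d : regfun D -> regfun D) :=
  [/\ forall f g, d (f + g) = d f + d g,
      forall f g, d (f * g) = d f * g + f * d g &
      forall (c : K) f, d (c *: f) = c *: d f].

Lemma mx_dag_derivation X (d : regfun D -> regfun D) :
  (forall f p, polyfun p -> (forall x, f x = p (sval x)) ->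
     forall x, d f x = mx_dag X p (sval x)) -> derivation d.
Proof.
move=> dX; split=> [f g|f g|c f]; apply/regfun_eqP => x;
  have [p pp fp] := regfun_polyfun f.
- have [q pq gq] := regfun_polyfun g.
  rewrite regfun_addE (dX f _ pp fp) (dX g _ pq gq).
  rewrite (dX _ (fun y => p y + q y)) ?mx_dagD //; first exact: polyfunD.
  by move=> y; rewrite regfun_addE fp gq.
- have [q pq gq] := regfun_polyfun g.
  rewrite regfun_addE !regfun_mulE (dX f _ pp fp) (dX g _ pq gq) fp gq.
  rewrite (dX _ (fun y => p y * q y)) ?mx_dagM //; first exact: polyfunM.
  by move=> y; rewrite regfun_mulE fp gq.
- rewrite regfun_scaleE (dX f _ pp fp) (dX _ (fun y => c * p y)).
  + exact: mx_dag_scale.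
  + by apply: polyfunM => //; exact: polyfun_cst.
  + by move=> y; rewrite regfun_scaleE fp.
Qed.

Lemma edag_derivation i : derivation (edag i).
Proof. by apply: mx_dag_derivation => f p; exact: edagE. Qed.

Lemma fdag_derivation i : derivation (fdag i).
Proof. by apply: mx_dag_derivation => f p; exact: fdagE. Qed.

Lemma hdag_derivation i : derivation (hdag i).
Proof. by apply: mx_dag_derivation => f p; exact: hdagE. Qed.

End Operators.

(** * SL_2 and its images in the group *)

Section SL2.
Variable (K : numFieldType).

Lemma mx2E (A : 'M[K]_2) :
  A = mx2 (A ord0 ord0) (A ord0 ord_max) (A ord_max ord0) (A ord_max ord_max).
Proof.
by apply/matrixP => -[[|[|//]] i] [[|[|//]] j]; rewrite !mxE /=;
  congr (A _ _); exact: val_inj.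
Qed.

Lemma mx2M (a b c d a' b' c' d' : K) :
  mx2 a b c d * mx2 a' b' c' d' =
  mx2 (a * a' + b * c') (a * b' + b * d') (c * a' + d * c') (c * b' + d * d').
Proof.
by rewrite [LHS]mx2E -mulmxE !mxE !big_ord_recl !big_ord0 !mxE /= !addr0.
Qed.

Lemma det_mx2 (a b c d : K) : \det (mx2 a b c d) = a * d - b * c.
Proof.
rewrite (expand_det_row _ ord0) !big_ord_recl big_ord0 addr0 /cofactor
  !det_mx11.
by rewrite !mxE /= expr0 expr1 mul1r mulN1r mulrN.
Qed.

End SL2.

Section GroupAction.
Variables (K : numFieldType) (n : nat) (D : G2_rep K n).
Variable phi : 'I_2 -> 'M[K]_2 -> G2_group D.
Hypothesis phi_hom : forall i, is_SL2_hom i (phi i).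
Implicit Types (f g : regfun D) (x : G2_group D) (i j : 'I_2) (s t : K).

Lemma phiM i (A B : 'M[K]_2) : \det A = 1 -> \det B = 1 ->
  sval (phi i (A * B)) = sval (phi i A) * sval (phi i B).
Proof. by case: (phi_hom i) => h _ _ hA hB; rewrite h. Qed.

Lemma phi_xmx i t : sval (phi i (mx2 1 t 0 1)) = xmx D i t.
Proof. by case: (phi_hom i) => _ -> _. Qed.

Lemma phi_ymx i t : sval (phi i (mx2 1 0 t 1)) = ymx D i t.
Proof. by case: (phi_hom i) => _ _ ->. Qed.

Lemma det_x t : \det (mx2 1 t 0 1) = 1.
Proof. by rewrite det_mx2 mulr1 mulr0 subr0. Qed.

Lemma det_y t : \det (mx2 1 0 t 1) = 1.
Proof. by rewrite det_mx2 mulr1 mul0r subr0. Qed.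

Lemma det_M (A B : 'M[K]_2) : \det A = 1 -> \det B = 1 -> \det (A * B) = 1.
Proof. by move=> hA hB; rewrite -mulmxE det_mulmx hA hB mulr1. Qed.

(** The exponential law is read off in SL_2 through [phi]. *)
Lemma xmxD i s t : xmx D i (s + t) = xmx D i s * xmx D i t.
Proof.
rewrite -!phi_xmx -phiM ?det_x //; congr (sval (phi i _)).
by rewrite mx2M; congr mx2; ring.
Qed.

Lemma ymxD i s t : ymx D i (s + t) = ymx D i s * ymx D i t.
Proof.
rewrite -!phi_ymx -phiM ?det_y //; congr (sval (phi i _)).
by rewrite mx2M; congr mx2; ring.
Qed.

Definition cochar i t := phi i (mx2 t 0 0 t^-1).

Lemma det_cochar t : t != 0 -> \det (mx2 t 0 0 t^-1) = 1.
Proof. by move=> t0; rewrite det_mx2 mulfV // mul0r subr0. Qed.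

Lemma cocharM i s t : s != 0 -> t != 0 ->
  sval (cochar i (s * t)) = sval (cochar i s) * sval (cochar i t).
Proof.
move=> s0 t0; rewrite /cochar -phiM ?det_cochar //; congr (sval (phi i _)).
by rewrite mx2M; congr mx2; rewrite ?invfM; ring.
Qed.

Lemma cochar1 i : sval (cochar i 1) = 1.
Proof. by rewrite /cochar invr1 phi_xmx xmx0. Qed.

(** Gauss elimination in SL_2: x(1) y(s) x(-1) has upper left entry 1 + s, and the outer factors
    clear its off-diagonal entries. The torus element becomes a product of exponentials, whose
    velocities are known. *)
Definition cochar_curve i s : 'M[K]_n :=
  ymx D i (- (s / (1 + s))) * (xmx D i 1 * ymx D i s * xmx D i (-1)) *
  xmx D i (s / (1 + s)).

Lemma cochar_curveE i s : 1 + s != 0 -> sval (cochar i (1 + s)) = cochar_curve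
  i s.
Proof.
move=> s0; rewrite /cochar_curve -!phi_xmx -!phi_ymx.
rewrite -!phiM ?(det_x, det_y, det_M) //; congr (sval (phi i _)).
by rewrite !mx2M; congr mx2; field.
Qed.

Lemma xmx_conj i : xmx D i 1 * chf D i * xmx D i (-1) =
  chf D i + chh D i - che D i.
Proof.
have [N eN] := che_nilpotent D i.
have ef : comm (che D i) (chf D i) = chh D i by rewrite comm_ef eqxx.
have eh : comm (che D i) (chh D i) = - 2 *: che D i.
  rewrite -[LHS]opprK /comm opprB -/(comm _ _) comm_he cartan_diag.
  by rewrite scaleNr scaler_nat.
have ee : comm (che D i) (- 2 *: che D i) = 0.
  by rewrite /comm -!mulmxE -scalemxAr -scalemxAl subrr.
rewrite /xmx scale1r (expm_conj eN ef eh ee) -mulrA.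
have -> : expm (che D i) = xmx D i 1 by rewrite /xmx scale1r.
rewrite -xmxD subrr xmx0 mulr1 scalerA mulrN mulVf ?pnatr_eq0 //.
by rewrite scaleN1r.
Qed.

(** At s = 0 the outer factors contribute -f and e, the conjugated one f + h - e, so only h
    remains. *)
Lemma mx_derive0_cochar_curve i (X : 'M[K]_n) :
  mx_derive0 (fun s => X * cochar_curve i s) (X * chh D i).
Proof.
have hu : is_derive (0 : K) 1 (fun s => s / (1 + s)) 1.
  have h1 : is_derive (0 : K) 1 (fun s : K => 1 + s) 1.
    have := is_deriveD (is_derive_cst (1 : K) (0 : K) (1 : K))
                       (is_derive_id (0 : K) (1 : K)).
    by rewrite add0r.
  have [h1d h1v] := h1.
  have h10 : (fun s : K => 1 + s) 0 != 0 by rewrite addr0 oner_eq0.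
  have h2 : is_derive (0 : K) 1 (fun s : K => (1 + s)^-1) (- 1).
    apply: DeriveDef; first exact: derivableV h10 h1d.
    by rewrite (deriveV h10 h1d) h1v addr0 expr1n invr1 /GRing.scale /= mulr1.
  have := is_deriveM (is_derive_id (0 : K) (1 : K)) h2.
  by move/is_derive_eq; apply; rewrite /GRing.scale /= mul0r add0r addr0 invr1
    mulr1.
have hNu : is_derive (0 : K) 1 (fun s => - (s / (1 + s))) (- 1).
  exact: is_deriveN.
have u0 : (0 : K) / (1 + 0) = 0 by rewrite mul0r.
have Nu0 : - ((0 : K) / (1 + 0)) = 0 by rewrite mul0r oppr0.
have dy := mx_derive0_ymx D i Nu0 hNu.
have dx := mx_derive0_xmx D i u0 hu.
have dm := mx_derive0M (mx_derive0M (mx_derive0_cst (xmx D i 1))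
  (mx_derive0_ymx D i erefl (is_derive_id (0 : K) (1 : K))))
  (mx_derive0_cst (xmx D i (-1))).
have := mx_derive0M (mx_derive0_cst X) (mx_derive0M (mx_derive0M dy dm) dx).
rewrite u0 oppr0 xmx0 !ymx0.
rewrite !(mulr1, mul1r, mulr0, mul0r, addr0, add0r, scale1r, scaleN1r).
rewrite -xmxD subrr xmx0 mulr1 mul1r xmx_conj.
suff -> : - chf D i + (chf D i + chh D i - che D i) + che D i = chh D i by [].
by rewrite -addrA subrK addKr.
Qed.

(* Along a one-parameter subgroup the coordinate 1 + s is used instead of an
   exponential parameter, which is why s = -1 is excluded. *)
Lemma hdag_cochar i f x (c d : K) :
  (forall s y, 1 + s != 0 -> sval y = sval x * sval (cochar i (1 + s)) ->
     f y = c + d * s) ->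
  hdag i f x = d.
Proof.
move=> fx; have [p pp fp] := regfun_polyfun f.
have c0 : cochar_curve i 0 = 1.
  by rewrite -cochar_curveE ?addr0 ?oner_eq0 // cochar1.
rewrite (hdagE i pp fp).
have h1 := is_derive_mx_dag pp _ (mx_derive0_cochar_curve i (sval x)).
have {}h1 : is_derive (0 : K) 1 (fun s => p (sval x * cochar_curve i s))
    (mx_dag (chh D i) p (sval x)).
  by apply: h1; rewrite c0 mulr1.
have h2 : is_derive (0 : K) 1 (fun s => c + d * s) d.
  have := is_deriveD (is_derive_cst (c : K) (0 : K) (1 : K))
    (is_deriveZ d (is_derive_id (0 : K) (1 : K))).
  by move/is_derive_eq; apply; rewrite add0r /GRing.scale /= mulr1.
have h3 : is_derive (0 : K) 1 (fun s => c + d * s)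
    (mx_dag (chh D i) p (sval x)).
  apply: near_eq_is_derive h1.
  near=> s.
  have s0 : 1 + s != 0.
    apply/eqP => /eqP; rewrite addrC addr_eq0 => /eqP sE.
    suff : `|s| < 1 by rewrite sE normrN normr1 ltxx.
    by near: s; exists 1 => //= z; rewrite /= sub0r normrN.
  by rewrite -cochar_curveE // -(fx s (G2_mul x (cochar i (1 + s)))) // fp.
by case: h3 => _ <-; case: h2 => _ ->.
Unshelve. all: by end_near.
Qed.

End GroupAction.

(** * Taylor expansion along one-parameter subgroups *)

Section Flow.
Variables (K : numFieldType) (n : nat) (D : G2_rep K n).
Variables (m : K -> G2_group D) (d : regfun D -> regfun D).
Hypothesis m_horner : exists P : 'I_n -> 'I_n -> {poly K},
  forall t k l, sval (m t) k l = (P k l).[t].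
Hypothesis mD : forall s t, sval (m (s + t)) = sval (m s) * sval (m t).
Hypothesis dE :
  forall f x, d f x = (fun t => f (G2_mul x (m t)))^`()%classic 0.

(** By the group law [d] becomes d/dt along the flow, so a single polynomial in t records all
    iterated derivatives of [f]. *)
Lemma flow_horner f x : exists Q : {poly K},
  forall k t, iter k d f (G2_mul x (m t)) = (Q^`(k)).[t].
Proof.
have [P mP] := m_horner; have [p pp fp] := regfun_polyfun f.
have [q [pq _]] := polyfun_horner mP pp.
exists (q (sval x)); elim=> [|k IHk] t; first by rewrite /= fp /= pq.
rewrite iterS derivnS dE.
set Q := (q (sval x))^`(k) in IHk *.
rewrite (_ : (fun s => _) = horner (Q \Po ('X + t%:P))); last first.
  apply/funext => s; rewrite horner_comp !hornerE addrC -IHk.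
  by apply: regfun_sval; rewrite /= mD mulrA.
rewrite derive1E (@derive_val _ _ _ _ _ _ _ (is_derive_horner _ _)).
by rewrite deriv_comp derivD derivX derivC addr0 mulr1 horner_comp !hornerE
  ?add0r.
Qed.

Lemma flow_taylor N f x t : iter N d f = 0 ->
  f (G2_mul x (m t)) =
    \sum_(k < N) (k`!)%:R^-1 * iter k d f (G2_mul x (m 0)) * t ^+ k.
Proof.
move=> dN; have [Q QP] := flow_horner f x.
have QN : Q^`(N) = 0 by apply: horner_eq0 => s; rewrite -QP dN.
have coefQ k : (k`!)%:R^-1 * iter k d f (G2_mul x (m 0)) = Q`_k.
  rewrite QP horner_coef0 coef_derivn addn0 ffactnn -(mulr_natl Q`_k) mulKf //.
  by rewrite pnatr_eq0 -lt0n fact_gt0.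
have := QP 0%N t; rewrite /= => ->.
rewrite (@horner_coef_wide _ N); first by apply: eq_bigr => k _; rewrite coefQ.
apply/leq_sizeP => k Nk; have := congr1 (fun p : {poly K} => p`_(k - N)) QN.
rewrite coef_derivn coef0 subnKC // => /eqP.
by rewrite mulrn_eq0 gtn_eqF ?ffact_gt0 //= => /eqP.
Qed.

Lemma flow_eq0 f x t : (forall k, iter k d f (G2_mul x (m 0)) = 0) ->
  f (G2_mul x (m t)) = 0.
Proof.
move=> d0; have [Q QP] := flow_horner f x.
have := QP 0%N t; rewrite /= => ->.
rewrite (_ : Q = 0) ?horner0 //; apply/polyP => k.
have := d0 k; rewrite QP horner_coef0 coef_derivn addn0 ffactnn => /eqP.
by rewrite mulrn_eq0 gtn_eqF ?fact_gt0 //= coef0 => /eqP.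
Qed.

End Flow.

(** * Words in derivations *)

Section Words.
Variables (K : numFieldType) (n : nat) (D : G2_rep K n).
Implicit Types (f : regfun D) (Z : regfun D -> Prop).

Definition linear_pred Z :=
  [/\ Z 0, forall f g, Z f -> Z g -> Z (f + g) & forall (c : K) f, Z f -> Z (c
    *: f)].

Lemma derivation0 d : derivation d -> d 0 = 0 :> regfun D.
Proof. by case=> _ _ dZ; rewrite -[0 in LHS](scale0r 0) dZ scale0r. Qed.

Variables (I : Type) (d : I -> regfun D -> regfun D).
Hypothesis dd : forall i, derivation (d i).

Lemma foldr_derivationD w f g :
  foldr d (f + g) w = foldr d f w + foldr d g w.
Proof. by elim: w => //= i w ->; case: (dd i) => -> . Qed.

Lemma foldr_derivationZ w (c : K) f :
  foldr d (c *: f) w = c *: foldr d f w.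
Proof. by elim: w => //= i w ->; case: (dd i) => _ _ ->. Qed.

Lemma foldr_derivation0 w : foldr d 0 w = 0.
Proof. by elim: w => //= i w ->; exact: derivation0. Qed.

(** For linear [Z], the largest subspace of [Z] stable under all [d i]. *)
Definition all_words Z f := forall w, Z (foldr d f w).

Lemma all_words_linear Z : linear_pred Z -> linear_pred (all_words Z).
Proof.
case=> Z0 ZD ZZ; split=> [w|f g Zf Zg w|c f Zf w].
- by rewrite foldr_derivation0.
- by rewrite foldr_derivationD; exact: ZD.
- by rewrite foldr_derivationZ; exact: ZZ.
Qed.

Lemma all_words_in Z f : all_words Z f -> Z f. Proof. by move/(_ [::]). Qed.

Lemma all_words_step Z i f : all_words Z f -> all_words Z (d i f).
Proof. by move=> Zf w; rewrite -foldr_rcons; exact: Zf. Qed.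

(* The commutation rule lets g be moved to the front of every word. *)
Lemma all_words_closed Z (g : regfun D -> regfun D) (c : I -> K)
    (r : I -> regfun D -> regfun D) :
  linear_pred Z -> (forall f, Z f -> Z (g f)) ->
  (forall i f, d i (g f) = g (d i f) + c i *: g f + r i f) ->
  (forall i f, all_words Z f -> all_words Z (r i f)) ->
  forall f, all_words Z f -> all_words Z (g f).
Proof.
move=> [Z0 ZD ZZ] Zg dg Wr f Wf w.
elim/last_ind: w f Wf => [|w i IHw] f Wf; first by apply: Zg; exact:
  all_words_in.
rewrite foldr_rcons dg !foldr_derivationD foldr_derivationZ.
apply: (ZD _ _ (ZD _ _ _ (ZZ _ _ _))); last exact: Wr.
- by apply: IHw; exact: all_words_step.
- exact: IHw.
Qed.

End Words.

(** * Density of the big cell *)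

Section Density.
Variables (K : numFieldType) (n : nat) (D : G2_rep K n).
Variable phi : 'I_2 -> 'M[K]_2 -> G2_group D.
Hypothesis phi_hom : forall i, is_SL2_hom i (phi i).
Implicit Types (f g : regfun D) (x y u v : G2_group D) (i j : 'I_2).

Lemma ymx_flow_eq0 i f x y t : sval y = sval x * ymx D i t ->
  (forall k, iter k (fdag i) f x = 0) -> f y = 0.
Proof.
move=> xy f0; rewrite (regfun_sval f (y := G2_mul x (yG D i t))) //.
apply: (@flow_eq0 _ _ _ (yG D i) (fdag i)) => //.
- exact: chf_horner.
- by move=> s s'; rewrite /= (ymxD phi_hom).
- by move=> k; rewrite -[RHS](f0 k); apply: regfun_sval; rewrite /= ymx0 mulr1.
Qed.

Lemma xmx_flow_eq0 i f x y t : sval y = sval x * xmx D i t ->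
  (forall k, iter k (edag i) f x = 0) -> f y = 0.
Proof.
move=> xy f0; rewrite (regfun_sval f (y := G2_mul x (xG D i t))) //.
apply: (@flow_eq0 _ _ _ (xG D i) (edag i)) => //.
- exact: che_horner.
- by move=> s s'; rewrite /= (xmxD phi_hom).
- by move=> k; rewrite -[RHS](f0 k); apply: regfun_sval; rewrite /= xmx0 mulr1.
Qed.

Lemma ymx_taylor i N f x t : iter N (fdag i) f = 0 ->
  f (G2_mul x (yG D i t)) =
    \sum_(k < N) (k`!)%:R^-1 * iter k (fdag i) f x * t ^+ k.
Proof.
move=> f0; rewrite (@flow_taylor _ _ _ (yG D i) (fdag i) _ _ _ N) //.
- apply: eq_bigr => k _; congr (_ * _ * _).
  by apply: regfun_sval; rewrite /= ymx0 mulr1.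
- exact: chf_horner.
- by move=> s s'; rewrite /= (ymxD phi_hom).
Qed.

Lemma xmx_taylor i N f x t : iter N (edag i) f = 0 ->
  f (G2_mul x (xG D i t)) =
    \sum_(k < N) (k`!)%:R^-1 * iter k (edag i) f x * t ^+ k.
Proof.
move=> f0; rewrite (@flow_taylor _ _ _ (xG D i) (edag i) _ _ _ N) //.
- apply: eq_bigr => k _; congr (_ * _ * _).
  by apply: regfun_sval; rewrite /= xmx0 mulr1.
- exact: che_horner.
- by move=> s s'; rewrite /= (xmxD phi_hom).
Qed.

Lemma fdag_eq0 i f x :
  (forall t y, sval y = sval x * ymx D i t -> f y = 0) -> fdag i f x = 0.
Proof.
move=> f0.
transitivity ((fun t => f (G2_mul x (yG D i t)))^`()%classic 0); first by [].
rewrite (_ : (fun t => _) = cst 0) ?derive1_cst //.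
by apply/funext => t; exact: (f0 t).
Qed.

Lemma edag_eq0 i f x :
  (forall t y, sval y = sval x * xmx D i t -> f y = 0) -> edag i f x = 0.
Proof.
move=> f0.
transitivity ((fun t => f (G2_mul x (xG D i t)))^`()%classic 0); first by [].
rewrite (_ : (fun t => _) = cst 0) ?derive1_cst //.
by apply/funext => t; exact: (f0 t).
Qed.

(* By Taylor expansion f is determined on G by its derivatives at 1. *)
Lemma stable_vanishing_eq0 (S : regfun D -> Prop) :
  (forall i f, S f -> S (edag i f)) -> (forall i f, S f -> S (fdag i f)) ->
  (forall f, S f -> f (G2_one D) = 0) -> forall f, S f -> f = 0.
Proof.
move=> SE SF S1 f Sf; apply/regfun_eqP => z.
have SiE i k h : S h -> S (iter k (edag i) h).
  by move=> Sh; elim: k => //= k; exact: SE.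
have SiF i k h : S h -> S (iter k (fdag i) h).
  by move=> Sh; elim: k => //= k; exact: SF.
suff main (g : 'M[K]_n) : G2_set D g ->
    forall x y, (forall f, S f -> f x = 0) ->
    sval y = sval x * g -> forall f, S f -> f y = 0.
  by apply: (main _ (svalP z) (G2_one D)) => //; rewrite /= mul1r.
elim=> {g} [_ [i [t [->|->]]]||g h Gg IHg Gh IHh] x y Sx.
- by move=> yE h Sh; apply: (xmx_flow_eq0 yE) => k; apply/Sx/SiE.
- by move=> yE h Sh; apply: (ymx_flow_eq0 yE) => k; apply/Sx/SiF.
- by rewrite mulr1 => yx h Sh; rewrite (regfun_sval h yx); exact: Sx.
- rewrite mulrA; pose xg := G2_mul x (exist _ g Gg).
  by apply: (IHh xg); exact: (IHg x).
Qed.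

Let T i t := sval (cochar phi i t).

Definition vanish_N f := forall x, Nminus D (sval x) -> f x = 0.
Definition vanish_NT1 f := forall x u (a : K), Nminus D (sval u) -> a != 0 ->
  sval x = sval u * T r1 a -> f x = 0.
Definition vanish_NT f := forall x u (a b : K), Nminus D (sval u) ->
  a != 0 -> b != 0 -> sval x = sval u * T r1 a * T r2 b -> f x = 0.
Definition vanish_cell f := forall x u v (a b : K),
  Nminus D (sval u) -> Nplus D (sval v) -> a != 0 -> b != 0 ->
  sval x = sval u * T r1 a * T r2 b * sval v -> f x = 0.

(** Infinitesimal forms of vanishing on the cell. An operator further left differentiates at a group
    factor further left, so in [kill] the words in h_1, in h_2 and in the e_i, read from left to
    right, stand for the factors T_1, T_2 and N^+. *)
Definition kill_H1 := all_words (fun _ : unit => @hdag K n D r1) vanish_N.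
Definition kill_H := all_words (fun _ : unit => @hdag K n D r2) kill_H1.
Definition kill := all_words (@edag K n D) kill_H.

Let dE := @edag_derivation K n D.
Let dH := @hdag_derivation K n D.

Lemma vanish_N_linear : linear_pred vanish_N.
Proof.
split=> [x _|f g f0 g0 x Nx|c f f0 x Nx]; first by [].
- by rewrite regfun_addE f0 // g0 // addr0.
- by rewrite regfun_scaleE f0 // mulr0.
Qed.

Lemma kill_H1_linear : linear_pred kill_H1.
Proof. by apply: all_words_linear vanish_N_linear => _; exact: dH. Qed.

Lemma kill_H_linear : linear_pred kill_H.
Proof. by apply: all_words_linear kill_H1_linear => _; exact: dH. Qed.

Lemma kill_linear : linear_pred kill.
Proof. by apply: all_words_linear kill_H_linear; exact: dE. Qed.

Lemma vanish_N_fdag j f : vanish_N f -> vanish_N (fdag j f).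
Proof.
move=> f0 x Nx; apply: fdag_eq0 => t y yx; apply: f0; rewrite yx.
by apply: monoid_genM => //; apply: monoid_gen_in; exists j, t.
Qed.

(** The trailing 0 is the remainder [r] of [all_words_closed]. *)
Lemma hdag_fdag_scale i j f :
  hdag i (fdag j f) = fdag j (hdag i f) + (- (cartan i j)%:~R : K) *: fdag j f
    + 0.
Proof. by rewrite hdag_fdag addr0 scaleNr scaler_int. Qed.

Lemma kill_H1_fdag j f : kill_H1 f -> kill_H1 (fdag j f).
Proof.
apply: (@all_words_closed _ _ _ _ _ (fun=> dH r1) vanish_N (fdag j)
  (fun=> - (cartan r1 j)%:~R) (fun _ _ => 0) vanish_N_linear).
- exact: vanish_N_fdag.
- by move=> _ g; exact: hdag_fdag_scale.
- by move=> _ g _; case: kill_H1_linear.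
Qed.

Lemma kill_H_fdag j f : kill_H f -> kill_H (fdag j f).
Proof.
apply: (@all_words_closed _ _ _ _ _ (fun=> dH r2) kill_H1 (fdag j)
  (fun=> - (cartan r2 j)%:~R) (fun _ _ => 0) kill_H1_linear).
- exact: kill_H1_fdag.
- by move=> _ g; exact: hdag_fdag_scale.
- by move=> _ g _; case: kill_H_linear.
Qed.

Lemma kill_H_hdag j f : kill_H f -> kill_H (hdag j f).
Proof.
have [->|->] : j = r1 \/ j = r2.
- by case: j => [[|[|//]] lj]; [left|right]; exact: val_inj.
- apply: (@all_words_closed _ _ _ _ _ (fun=> dH r2) kill_H1 (hdag r1)
    (fun=> 0) (fun _ _ => 0) kill_H1_linear).
  + by move=> g; exact: (all_words_step tt).
  + by move=> _ g; rewrite hdag_comm scale0r !addr0.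
  + by move=> _ g _; case: kill_H_linear.
- exact: (all_words_step tt).
Qed.

Lemma kill_hdag j f : kill f -> kill (hdag j f).
Proof.
apply: (@all_words_closed _ _ _ _ _ dE kill_H (hdag j)
  (fun=> 0) (fun i f => - (cartan j i)%:~R *: edag i f) kill_H_linear).
- exact: kill_H_hdag.
- by move=> i g; rewrite hdag_edag scale0r addr0 scaleNr scaler_int addrK.
- move=> i g kg; case: kill_linear => _ _; apply.
  exact: all_words_step.
Qed.

(** Triangular decomposition: moving f_j to the left past e-words and h-words creates only terms in
    h_j and f_j, and vanishing on N^- survives f_j because N^- is closed under right multiplication
    by y_j(t). *)
Lemma kill_fdag j f : kill f -> kill (fdag j f).
Proof.
apply: (@all_words_closed _ _ _ _ _ dE kill_H (fdag j)
  (fun=> 0) (fun i f => if i == j then hdag i f else 0) kill_H_linear).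
- exact: kill_H_fdag.
- by move=> i g; rewrite edag_fdag scale0r addr0.
- move=> i g; case: eqP => [_|_ _]; first exact: kill_hdag.
  by case: kill_linear.
Qed.

Lemma kill_eq0 f : kill f -> f = 0.
Proof.
apply: (stable_vanishing_eq0 (S := kill)).
- by move=> i g; exact: all_words_step.
- exact: kill_fdag.
- move=> g /all_words_in/all_words_in/all_words_in; apply.
  exact: monoid_gen1.
Qed.

Lemma T1 i : T i 1 = 1. Proof. exact: cochar1. Qed.

Lemma TM i (s t : K) : s != 0 -> t != 0 -> T i (s * t) = T i s * T i t.
Proof. exact: cocharM. Qed.

Lemma vanish_NT1_hdag f : vanish_NT1 f -> vanish_NT1 (hdag r1 f).
Proof.
move=> f0 x u a Nu a0 xE.
apply: (hdag_cochar phi_hom (c := 0)) => s y s0 yE.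
rewrite mul0r addr0; apply: (f0 _ u (a * (1 + s))) => //.
  exact: mulf_neq0.
by rewrite yE xE TM // mulrA.
Qed.

Lemma vanish_NT_hdag f : vanish_NT f -> vanish_NT (hdag r2 f).
Proof.
move=> f0 x u a b Nu a0 b0 xE.
apply: (hdag_cochar phi_hom (c := 0)) => s y s0 yE.
rewrite mul0r addr0; apply: (f0 _ u a (b * (1 + s))) => //.
  exact: mulf_neq0.
by rewrite yE xE TM // mulrA.
Qed.

Lemma vanish_cell_edag i f : vanish_cell f -> vanish_cell (edag i f).
Proof.
move=> f0 x u v a b Nu Nv a0 b0 xE; apply: edag_eq0 => t y yE.
apply: (f0 y u (G2_mul v (xG D i t)) a b) => //.
  by apply: monoid_genM => //; apply: monoid_gen_in; exists i, t.
by rewrite yE xE /= !mulrA.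
Qed.

Lemma vanish_NT1_kill f : vanish_NT1 f -> kill_H1 f.
Proof.
move=> f0 w x Nx.
have {f0} : vanish_NT1 (foldr (fun=> hdag r1) f w).
  by elim: w => //= _ w; exact: vanish_NT1_hdag.
by move/(_ x x 1); apply; rewrite ?oner_eq0 ?T1 ?mulr1.
Qed.

Lemma vanish_NT_kill f : vanish_NT f -> kill_H f.
Proof.
move=> f0 w; apply: vanish_NT1_kill => x u a Nu a0 xE.
have {f0} : vanish_NT (foldr (fun=> hdag r2) f w).
  by elim: w => //= _ w; exact: vanish_NT_hdag.
by move/(_ x u a 1); apply; rewrite ?oner_eq0 ?T1 ?mulr1.
Qed.

(** Words of derivations absorb the factors N^+, T_2, T_1 of the cell in turn, after which each
    factor is specialized to 1. *)
Lemma vanish_cell_eq0 f : vanish_cell f -> f = 0.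
Proof.
move=> f0; apply: kill_eq0 => w; apply: vanish_NT_kill => x u a b Nu a0 b0 xE.
have {f0} : vanish_cell (foldr (@edag K n D) f w).
  by elim: w => //= i w; exact: vanish_cell_edag.
by move/(_ x u (G2_one D) a b); apply; rewrite ?xE ?mulr1 //; exact:
  monoid_gen1.
Qed.

End Density.

(** * Highest weight vectors *)

Section HighestWeight.
Variables (K : numFieldType) (n : nat) (D : G2_rep K n).
Variable phi : 'I_2 -> 'M[K]_2 -> G2_group D.
Hypothesis phi_hom : forall i, is_SL2_hom i (phi i).
Implicit Types (f g : regfun D) (x y u v : G2_group D) (i j : 'I_2).

(** The product is tested through [sval], so that [y] may be any group element with the right
    matrix, whatever its membership proof. *)
Definition left_Nminus_invariant f := forall u x y,
  Nminus D (sval u) -> sval y = sval u * sval x -> f y = f x.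

Let linv := left_Nminus_invariant.

Lemma left_invariantD f g : linv f -> linv g -> linv (f + g).
Proof. by move=> Lf Lg u x y Nu yE; rewrite !regfun_addE (Lf u x) // (Lg u x).
  Qed.

Lemma left_invariantM f g : linv f -> linv g -> linv (f * g).
Proof. by move=> Lf Lg u x y Nu yE; rewrite !regfun_mulE (Lf u x) // (Lg u x).
  Qed.

Lemma left_invariantZ (c : K) f : linv f -> linv (c *: f).
Proof. by move=> Lf u x y Nu yE; rewrite !regfun_scaleE (Lf u x). Qed.

Lemma left_invariant_fdag i f : linv f -> linv (fdag i f).
Proof.
move=> Lf u x y Nu yE.
transitivity ((fun t => f (G2_mul y (yG D i t)))^`()%classic 0); first by [].
rewrite (_ : (fun t => _) = (fun t => f (G2_mul x (yG D i t)))) //.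
by apply/funext => t; apply: (Lf u) => //=; rewrite yE mulrA.
Qed.

(** At 1, right and left translation by y_i(t) coincide, so [f] is constant along the curve. *)
Lemma left_invariant_fdag1 i f : linv f -> fdag i f (G2_one D) = 0.
Proof.
move=> Lf.
transitivity ((fun t => f (G2_mul (G2_one D) (yG D i t)))^`()%classic 0);
  first by [].
rewrite (_ : (fun t => _) = cst (f (G2_one D))) ?derive1_cst //.
apply/funext => t; apply: (Lf (yG D i t)).
  by apply: monoid_gen_in; exists i, t.
by rewrite /= mulr1 mul1r.
Qed.

(** The module over U(n^-) generated by [f]. *)
Inductive lowering_span f : regfun D -> Prop :=
| lowering_span_gen : lowering_span f f
| lowering_spanD g h :
    lowering_span f g -> lowering_span f h -> lowering_span f (g + h)
| lowering_spanZ (c : K) g : lowering_span f g -> lowering_span f (c *: g)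
| lowering_spanF i g : lowering_span f g -> lowering_span f (fdag i g).

Lemma lowering_span0 f : lowering_span f 0.
Proof. by rewrite -(scale0r f); exact/lowering_spanZ/lowering_span_gen. Qed.

Lemma lowering_spanZint f (c : int) g :
  lowering_span f g -> lowering_span f (g *~ c).
Proof. by rewrite -scaler_int; exact: lowering_spanZ. Qed.

Lemma lowering_span_hdag f (c : 'I_2 -> int) :
  (forall i, hdag i f = f *~ c i) ->
  forall g, lowering_span f g -> forall i, lowering_span f (hdag i g).
Proof.
move=> Hf g; elim=> {g} [|g h _ Sg _ Sh|b g _ Sg|j g Fg Sg] i.
- by rewrite Hf; apply: lowering_spanZint; exact: lowering_span_gen.
- by case: (hdag_derivation D i) => -> _ _; exact: lowering_spanD.
- by case: (hdag_derivation D i) => _ _ ->; exact: lowering_spanZ.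
- rewrite hdag_fdag -mulrNz; apply: lowering_spanD; first exact: lowering_spanF.
  by apply: lowering_spanZint; exact: lowering_spanF.
Qed.

Lemma lowering_span_edag f (c : 'I_2 -> int) :
  (forall i, edag i f = 0) -> (forall i, hdag i f = f *~ c i) ->
  forall g, lowering_span f g -> forall i, lowering_span f (edag i g).
Proof.
move=> Ef Hf g; elim=> {g} [|g h _ Sg _ Sh|b g _ Sg|j g Fg Sg] i.
- by rewrite Ef; exact: lowering_span0.
- by case: (edag_derivation D i) => -> _ _; exact: lowering_spanD.
- by case: (edag_derivation D i) => _ _ ->; exact: lowering_spanZ.
- rewrite edag_fdag; apply: lowering_spanD; first exact: lowering_spanF.
  case: eqP => _; last exact: lowering_span0.
  exact: lowering_span_hdag Fg i.
Qed.

Lemma lowering_span_linv f g : linv f -> lowering_span f g -> linv g.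
Proof.
move=> Lf; elim=> {g} [|g h _ Lg _ Lh|b g _ Lg|j g _ Lg] //.
- exact: left_invariantD.
- exact: left_invariantZ.
- exact: left_invariant_fdag.
Qed.

(* By the commutation relations f generates a submodule spanned by lowering
   words; each of these vanishes at 1, by left invariance. *)
Lemma singular_eq0 f (c : 'I_2 -> int) : linv f ->
  (forall i, edag i f = 0) -> (forall i, hdag i f = f *~ c i) ->
  f (G2_one D) = 0 -> f = 0.
Proof.
move=> Lf Ef Hf f1.
apply: (stable_vanishing_eq0 phi_hom (S := lowering_span f)).
- by move=> i g Sg; exact: lowering_span_edag Sg i.
- by move=> i g; exact: lowering_spanF.
- move=> g; elim=> {g} [|g h _ g1 _ h1|b g _ g1|i g Sg _] //.
  + by rewrite regfun_addE g1 h1 addr0.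
  + by rewrite regfun_scaleE g1 mulr0.
  + exact/left_invariant_fdag1/(lowering_span_linv Lf).
- exact: lowering_span_gen.
Qed.

Variable Delta2 : regfun D.
Hypothesis Delta2_minor : is_principal_minor phi r2 Delta2.

Let T i t := sval (cochar phi i t).

Lemma principal_minor_cell x u v (a b : K) :
  Nminus D (sval u) -> Nplus D (sval v) -> a != 0 -> b != 0 ->
  sval x = sval u * T r1 a * T r2 b * sval v -> Delta2 x = b.
Proof.
move=> Nu Nv a0 b0 xE.
have := @Delta2_minor u v (fun j => if j == r1 then a else b) Nu Nv.
rewrite /= => <-; last by move=> j; case: ifP.
by apply: regfun_sval; rewrite xE /= !mulrA.
Qed.

Lemma edag_principal_minor i : edag i Delta2 = 0.
Proof.
apply: (vanish_cell_eq0 phi_hom) => x u v a b Nu Nv a0 b0 xE.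
transitivity ((fun t => Delta2 (G2_mul x (xG D i t)))^`()%classic 0);
  first by [].
rewrite (_ : (fun t => _) = cst b) ?derive1_cst //.
apply/funext => t.
apply: (@principal_minor_cell _ u (G2_mul v (xG D i t)) a b) => //.
  by apply: monoid_genM => //; apply: monoid_gen_in; exists i, t.
by rewrite /= xE !mulrA.
Qed.

(** Only the empty e-word contributes, so it is enough to look at N^- H. *)
Lemma raising_kill f : (forall i, edag i f = 0) -> kill_H f -> kill f.
Proof.
move=> Ef Hf w; case/lastP: w => [//|w i].
rewrite foldr_rcons Ef foldr_derivation0; last exact: edag_derivation.
by case: (kill_H_linear D).
Qed.

(** The curve in T_2 is appended on the right. On N^- H this turns the value b into b (1 + s), with
    derivative b; on the full cell it would first have to be moved past N^+, hence the detour
    through [raising_kill]. *)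
Lemma hdag2_principal_minor : hdag r2 Delta2 = Delta2.
Proof.
apply/eqP; rewrite -subr_eq0; apply/eqP; apply: (kill_eq0 phi_hom).
apply: raising_kill => [i|].
  case: (edag_derivation D i) => ED _ EZ.
  rewrite -scaleN1r ED EZ edag_principal_minor scaler0 addr0.
  have /eqP := hdag_edag r2 i Delta2; rewrite edag_principal_minor mul0rz addr0.
  by rewrite (derivation0 (hdag_derivation D r2)) => /eqP <-.
apply: (vanish_NT_kill phi_hom) => x u a b Nu a0 b0 xE.
have N1 : Nplus D (sval (G2_one D)) by exact: monoid_gen1.
rewrite regfun_addE regfun_oppE.
rewrite (@principal_minor_cell x u (G2_one D) a b) //; last by rewrite mulr1.
apply/eqP; rewrite subr_eq0; apply/eqP.
apply: (hdag_cochar phi_hom (c := b)) => s y s0 yE.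
rewrite (@principal_minor_cell y u (G2_one D) a (b * (1 + s))) //.
- by rewrite mulrDr mulr1.
- exact: mulf_neq0.
- by rewrite yE xE /T cocharM // mulr1 mulrA.
Qed.

Lemma hdag1_principal_minor : hdag r1 Delta2 = 0.
Proof.
apply: (kill_eq0 phi_hom).
apply: raising_kill => [i|].
  have /eqP := hdag_edag r1 i Delta2; rewrite edag_principal_minor mul0rz addr0.
  by rewrite (derivation0 (hdag_derivation D r1)) => /eqP <-.
(* T_1 stands to the left of T_2, so the h_2-words are disposed of first: h_2 commutes with h_1 and
   fixes Delta^(omega_2). What remains is tested on N^- T_1. *)
move=> w; have -> : foldr (fun=> hdag r2) (hdag r1 Delta2) w = hdag r1 Delta2.
  by elim: w => //= _ w ->; rewrite hdag_comm hdag2_principal_minor.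
apply: (vanish_NT1_kill phi_hom) => x u a Nu a0 xE.
apply: (hdag_cochar phi_hom (c := 1)) => s y s0 yE.
rewrite (@principal_minor_cell y u (G2_one D) (a * (1 + s)) 1).
- by rewrite mul0r addr0.
- by [].
- exact: monoid_gen1.
- exact: mulf_neq0.
- exact: oner_neq0.
- by rewrite yE xE /T cocharM // cochar1 // !mulr1 mulrA.
Qed.

Lemma principal_minor1 : Delta2 (G2_one D) = 1.
Proof.
apply: (@principal_minor_cell _ (G2_one D) (G2_one D) 1 1);
  rewrite ?oner_neq0 //; try exact: monoid_gen1.
by rewrite /T !cochar1 // !mulr1.
Qed.

Lemma polyfun_ltrans (A : 'M[K]_n) p :
  polyfun p -> polyfun (fun X => p (A * X)).
Proof.
elim=> {p} [c|i j|p q _ IHp _ IHq|p q _ IHp _ IHq].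
- exact: polyfun_cst.
- under eq_fun do rewrite -mulmxE mxE.
  apply: polyfun_sum => l; apply: polyfunM; first exact: polyfun_cst.
  exact: polyfun_coord.
- exact: polyfunD.
- exact: polyfunM.
Qed.

(** Left translation by N^- preserves the cell and the torus component, so both functions agree on
    the cell. *)
Lemma left_invariant_principal_minor : linv Delta2.
Proof.
move=> u x y Nu yE.
have reg : (fun z => Delta2 (G2_mul u z)) \in @is_regular _ _ D.
  have [p pp fp] := regfun_polyfun Delta2.
  apply/is_regularP; exists (fun z => p (sval u * z)); first exact:
    polyfun_ltrans.
  by move=> z; rewrite fp.
suff /regfun_eqP/(_ x) : RegFun reg = Delta2.
  by move=> /= <-; exact: regfun_sval.
apply/eqP; rewrite -subr_eq0; apply/eqP; apply: (vanish_cell_eq0 phi_hom).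
move=> z v w a b Nv Nw a0 b0 zE.
rewrite regfun_addE regfun_oppE (principal_minor_cell Nv Nw a0 b0 zE).
rewrite [RegFun _ _](@principal_minor_cell _ (G2_mul u v) w a b) ?subrr //.
  exact: monoid_genM.
by rewrite /= zE !mulrA.
Qed.

End HighestWeight.

(** * Lifts of simple reflections acting on strings *)

Section WeylAction.
Variables (K : numFieldType) (n : nat) (D : G2_rep K n).
Variable phi : 'I_2 -> 'M[K]_2 -> G2_group D.
Hypothesis phi_hom : forall i, is_SL2_hom i (phi i).
Implicit Types (f g : regfun D) (x y u v : G2_group D) (i j : 'I_2).

Lemma sbarE i :
  sval (sbar phi i) = xmx D i (-1) * ymx D i 1 * xmx D i (-1).
Proof.
rewrite -!(phi_xmx phi_hom) -!(phi_ymx phi_hom) -!(phiM phi_hom);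
  rewrite ?(det_x, det_y, det_M) //.
by congr (sval (phi i _)); rewrite !mx2M; congr mx2; ring.
Qed.

Section String.
Variables (i : 'I_2) (m : nat) (f : regfun D).
Hypothesis Ef : edag i f = 0.
Hypothesis Hf : hdag i f = m%:R *: f.
Hypothesis Ff : iter m.+1 (fdag i) f = 0.

Definition divided_lowering k : regfun D := (k`!)%:R^-1 *: iter k (fdag i) f.

Lemma hdag_string k :
  hdag i (iter k (fdag i) f) = (m%:R - (2 * k)%:R) *: iter k (fdag i) f.
Proof.
elim: k => [|k IHk]; first by rewrite muln0 subr0.
rewrite iterS hdag_fdag IHk cartan_diag.
case: (fdag_derivation D i) => _ _ ->; rewrite -scaler_int -scalerBl.
congr (_ *: _); rewrite mulnS natrD -[(2 : int)%:~R]/(2 : K).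
by move: ((2 * k)%:R : K) (m%:R : K) => a b; ring.
Qed.

Lemma edag_string k : edag i (iter k.+1 (fdag i) f) =
  (k.+1%:R * (m%:R - k%:R)) *: iter k (fdag i) f.
Proof.
elim: k => [|k IHk].
  rewrite /= edag_fdag eqxx Ef (derivation0 (fdag_derivation D i)) add0r Hf.
  by rewrite subr0 mul1r.
rewrite iterS edag_fdag eqxx IHk hdag_string.
case: (fdag_derivation D i) => _ _ ->; rewrite -iterS -scalerDl.
congr (_ *: _); rewrite natrM -(natr1 k.+1) -(natr1 k).
by move: (k%:R : K) (m%:R : K) => a b; ring.
Qed.

Lemma edag_divided k : edag i (divided_lowering k.+1) = (m%:R - k%:R) *:
  divided_lowering k.
Proof.
rewrite /divided_lowering; case: (edag_derivation D i) => _ _ ->.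
rewrite edag_string !scalerA; congr (_ *: _).
rewrite factS natrM invfM; have : k.+1%:R != 0 :> K by rewrite pnatr_eq0.
by move: (k.+1%:R : K) ((k`!)%:R^-1 : K) (_ - _) => c b a c0; field.
Qed.

Lemma iter_edag_divided (j k : nat) : (j <= k <= m)%N ->
  iter j (edag i) (divided_lowering k) = ((m - (k - j)) ^_ j)%:R *:
    divided_lowering (k - j).
Proof.
case/andP=> jk km; elim: j jk => [|j IHj] jk.
  by rewrite subn0 ffactn0 scale1r.
rewrite iterS IHj ?(ltnW jk) // -(subnSK jk).
case: (edag_derivation D i) => _ _ ->; rewrite edag_divided scalerA.
set r := (k - j.+1)%N.
have rm : (r <= m)%N by exact: leq_trans (leq_subr _ _) km.
by rewrite -natrB // -natrM ffactnS subnS mulnC.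
Qed.

(** This exponentiates -e_i on a string: e_i^j / j! sends the k-th divided power to binom(m - k + j,
    j) times the (k - j)-th, and r = k - j. *)
Lemma divided_trans_x k x : (k <= m)%N ->
  divided_lowering k (G2_mul x (xG D i (-1))) =
  \sum_(r < m.+1 | (r <= k)%N) (-1) ^+ (k - r) *+ 'C(m - r, k - r) *
    divided_lowering r x.
Proof.
move=> km; rewrite (xmx_taylor phi_hom (N := k.+1)); last first.
  rewrite iterS iter_edag_divided ?leqnn // subnn.
  case: (edag_derivation D i) => _ _ ->.
  by rewrite /divided_lowering iter0 fact0 invr1 scale1r Ef scaler0.
have step r : (r <= k)%N -> ((k - r)`!)%:R^-1 *
    iter (k - r) (edag i) (divided_lowering k) x * (-1) ^+ (k - r) =
    (-1) ^+ (k - r) *+ 'C(m - r, k - r) * divided_lowering r x.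
  move=> rk; rewrite iter_edag_divided ?leq_subr // subKn //.
  rewrite (regfun_scaleE _ (divided_lowering r)).
  have -> : ((m - r) ^_ (k - r))%:R = 'C(m - r, k - r)%:R * ((k - r)`!)%:R :> K.
    by rewrite -natrM bin_ffact.
  have : ((k - r)`!)%:R != 0 :> K by rewrite pnatr_eq0 -lt0n fact_gt0.
  rewrite -[(-1) ^+ _ *+ _]mulr_natr.
  move: ('C(_, _)%:R : K) (_`!%:R : K) ((-1) ^+ _) (divided_lowering r x) => b
    c e y c0.
  by field.
rewrite (reindex_inj rev_ord_inj) (big_ord_narrow_leq km).
by apply: eq_bigr => r _; apply: step; rewrite -ltnS.
Qed.

(* The alternating sums of binomial coefficients that arise are
   (1 - 1)^(m - r). *)
Lemma rtrans_sbar : rtrans (sbar phi i) f = (m`!)%:R^-1 *: iter m (fdag i) f.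
Proof.
apply/regfun_eqP => x; rewrite -[RHS]/(divided_lowering m x).
have inv y : f (G2_mul y (xG D i (-1))) = f y.
  rewrite (xmx_taylor phi_hom (N := 1)) //.
  by rewrite big_ord1 fact0 invr1 mul1r expr0 mulr1.
pose x1 := G2_mul x (xG D i (-1)).
transitivity (f (G2_mul (G2_mul x1 (yG D i 1)) (xG D i (-1)))).
  rewrite -[LHS]/(f (G2_mul x (sbar phi i))).
  by apply: regfun_sval; rewrite /= sbarE !mulrA.
rewrite inv (ymx_taylor phi_hom (N := m.+1)) //.
have -> : \sum_(k < m.+1) (k`!)%:R^-1 * iter k (fdag i) f x1 * 1 ^+ k =
    \sum_(k < m.+1) \sum_(r < m.+1 | (r <= k)%N)
      (-1) ^+ (k - r) *+ 'C(m - r, k - r) * divided_lowering r x.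
  apply: eq_bigr => k _; rewrite expr1n mulr1.
  by rewrite -divided_trans_x // -ltnS.
rewrite (exchange_big_dep xpredT) //= big_ord_recr /=.
rewrite [X in _ + X](big_pred1 (ord_max : 'I_m.+1)); last first.
  by move=> k; rewrite /= -val_eqE /= [RHS]eqn_leq -[X in X && _]ltnS ltn_ord.
rewrite /= subnn bin0 expr0 mul1r big1 ?add0r // => r _.
rewrite -mulr_suml (_ : \sum_(_ < _ | _) _ = (1 - 1) ^+ (m - r)).
  by rewrite subrr expr0n subn_eq0 leqNgt /= ltn_ord mul0r.
rewrite exprBn.
rewrite -(big_geq_mkord r m.+1 predT
  (fun k => (-1) ^+ (k - r) *+ 'C(m - r, k - r))).
rewrite -{1}[(r : nat)]add0n big_addn (subSn (ltnW (ltn_ord r))) big_mkord.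
by apply: eq_bigr => k _; rewrite addnK !expr1n !mulr1.
Qed.

End String.
End WeylAction.

(** * Relations in the adjoint module *)

Section AdjointModule.
Variables (A : idomainType) (E F H : 'I_2 -> A -> A).
Hypothesis natA_neq0 : forall n, n.+1%:R != 0 :> A.
Hypothesis ED : forall i a b, E i (a + b) = E i a + E i b.
Hypothesis EM : forall i a b, E i (a * b) = E i a * b + a * E i b.
Hypothesis FD : forall i a b, F i (a + b) = F i a + F i b.
Hypothesis FM : forall i a b, F i (a * b) = F i a * b + a * F i b.
Hypothesis HD : forall i a b, H i (a + b) = H i a + H i b.
Hypothesis HM : forall i a b, H i (a * b) = H i a * b + a * H i b.
Hypothesis EF : forall i j a,
  E i (F j a) = F j (E i a) + (if i == j then H i a else 0).
Hypothesis HF : forall i j a, H i (F j a) = F j (H i a) - F j a *~ cartan i j.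

(* V is the ideal, among the functions satisfying L, of those vanishing at 1. *)
Variables L V : A -> Prop.
Hypothesis V_L : forall a, V a -> L a.
Hypothesis V_F : forall i a, L a -> V (F i a).
Hypothesis V_D : forall a b, V a -> V b -> V (a + b).
Hypothesis V_M : forall a b, L a -> V b -> V (a * b).
Hypothesis V_nat : forall n, L n%:R.
Hypothesis V_N1 : L (-1).
Hypothesis V_div : forall n a, V (a *+ n.+1) -> V a.
Hypothesis singular : forall a (c : 'I_2 -> int), V a ->
  (forall i, E i a = 0) -> (forall i, H i a = a *~ c i) -> a = 0.

Local Notation E1 := (E r1).
Local Notation E2 := (E r2).
Local Notation F1 := (F r1).
Local Notation F2 := (F r2).
Local Notation H1 := (H r1).
Local Notation H2 := (H r2).

Lemma natcancel n (a b : A) : n.+1%:R * a = n.+1%:R * b -> a = b.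
Proof. by move/(mulfI (natA_neq0 n)). Qed.

Lemma additive0 (d : A -> A) : {morph d : a b / a + b} -> d 0 = 0.
Proof. by move=> dD; apply: (@addrI _ (d 0)); rewrite -dD !addr0. Qed.

Lemma additiveN (d : A -> A) : {morph d : a b / a + b} -> {morph d : a / - a}.
Proof.
move=> dD a; apply/eqP; rewrite -addr_eq0 -dD addNr.
by rewrite (additive0 dD).
Qed.

Lemma additive_mulrn (d : A -> A) n :
  {morph d : a b / a + b} -> {morph d : a / a *+ n}.
Proof.
move=> dD a; elim: n => [|n IHn]; first by rewrite (additive0 dD).
by rewrite !mulrS dD IHn.
Qed.

Lemma additive_nat (d : A -> A) n :
  {morph d : a b / a + b} -> {morph d : a / n%:R * a}.
Proof. by move=> dD a; rewrite !mulr_natl (additive_mulrn _ dD). Qed.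

Lemma additive_int (d : A -> A) (c : int) :
  {morph d : a b / a + b} -> {morph d : a / a *~ c}.
Proof.
move=> dD a; case: c => n; first by rewrite -!pmulrn (additive_mulrn _ dD).
by rewrite NegzE !mulrNz (additiveN dD) -!pmulrn (additive_mulrn _ dD).
Qed.

Let E1D : {morph E1 : a b / a + b} := ED r1.
Let E2D : {morph E2 : a b / a + b} := ED r2.
Let F1D : {morph F1 : a b / a + b} := FD r1.
Let F2D : {morph F2 : a b / a + b} := FD r2.
Let H1D : {morph H1 : a b / a + b} := HD r1.
Let H2D : {morph H2 : a b / a + b} := HD r2.
Let E10 := additive0 E1D.
Let E20 := additive0 E2D.
Let F10 := additive0 F1D.
Let F20 := additive0 F2D.
Let E1n n a : E1 (n%:R * a) = n%:R * E1 a. Proof. exact: additive_nat. Qed.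
Let E2n n a : E2 (n%:R * a) = n%:R * E2 a. Proof. exact: additive_nat. Qed.
Let F1n n a : F1 (n%:R * a) = n%:R * F1 a. Proof. exact: additive_nat. Qed.
Let F2n n a : F2 (n%:R * a) = n%:R * F2 a. Proof. exact: additive_nat. Qed.
Let E1N := additiveN E1D.
Let E2N := additiveN E2D.
Let F1N := additiveN F1D.
Let F2N := additiveN F2D.

Lemma EF11 a : E1 (F1 a) = F1 (E1 a) + H1 a. Proof. exact: EF. Qed.
Lemma EF12 a : E1 (F2 a) = F2 (E1 a). Proof. by rewrite [LHS]EF addr0. Qed.
Lemma EF21 a : E2 (F1 a) = F1 (E2 a). Proof. by rewrite [LHS]EF addr0. Qed.
Lemma EF22 a : E2 (F2 a) = F2 (E2 a) + H2 a. Proof. exact: EF. Qed.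

Definition weight (c1 c2 : int) a := H1 a = a *~ c1 /\ H2 a = a *~ c2.

Lemma weightF1 c1 c2 a : weight c1 c2 a -> weight (c1 - 2) (c2 + 1) (F1 a).
Proof.
case=> h1 h2; split.
  rewrite [LHS]HF h1 (additive_int _ F1D).
  by rewrite -[cartan r1 r1]/(2 : int) -mulrzBr.
rewrite [LHS]HF h2 (additive_int _ F1D).
by rewrite -[cartan r2 r1]/(-1 : int) -mulrzBr opprK.
Qed.

Lemma weightF2 c1 c2 a : weight c1 c2 a -> weight (c1 + 3) (c2 - 2) (F2 a).
Proof.
case=> h1 h2; split.
  rewrite [LHS]HF h1 (additive_int _ F2D).
  by rewrite -[cartan r1 r2]/(-3 : int) -mulrzBr opprK.
rewrite [LHS]HF h2 (additive_int _ F2D).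
by rewrite -[cartan r2 r2]/(2 : int) -mulrzBr.
Qed.

Lemma weightD c1 c2 a b : weight c1 c2 a -> weight c1 c2 b ->
  weight c1 c2 (a + b).
Proof.
by move=> [h1 h2] [k1 k2]; rewrite /weight H1D H2D h1 h2 k1 k2 -!mulrzDl.
Qed.

Lemma weightN c1 c2 a : weight c1 c2 a -> weight c1 c2 (- a).
Proof.
by move=> [h1 h2]; rewrite /weight (additiveN H1D) (additiveN H2D) h1 h2
  !mulNrz.
Qed.

Lemma weight_nat c1 c2 n a : weight c1 c2 a -> weight c1 c2 (n%:R * a).
Proof.
move=> [h1 h2].
by rewrite /weight (additive_nat _ H1D) (additive_nat _ H2D) h1 h2 -!mulrzAr.
Qed.

Lemma weight_div c1 c2 n a :
  weight c1 c2 (n.+1%:R * a) -> weight c1 c2 a.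
Proof.
case; rewrite (additive_nat _ H1D) (additive_nat _ H2D) -!mulrzAr.
by move=> /natcancel h1 /natcancel h2.
Qed.

Lemma weightM c1 c2 d1 d2 a b : weight c1 c2 a -> weight d1 d2 b ->
  weight (c1 + d1) (c2 + d2) (a * b).
Proof.
move=> [h1 h2] [k1 k2]; rewrite /weight !HM h1 h2 k1 k2.
by rewrite !mulrzDr !mulrzAl !mulrzAr.
Qed.

Lemma singular_weight c1 c2 a : V a -> weight c1 c2 a -> E1 a = 0 -> E2 a = 0 ->
  a = 0.
Proof.
move=> Va [h1 h2] e1 e2.
have I2 (P : 'I_2 -> Prop) : P r1 -> P r2 -> forall i, P i.
  by move=> P1 P2 [[|[|//]] li]; [move: P1|move: P2]; congr P; exact: val_inj.
by apply: (@singular a (fun i => if i == r1 then c1 else c2)) => //; exact: I2.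
Qed.

Lemma V_N a : V a -> V (- a).
Proof. by rewrite -mulN1r; exact: V_M. Qed.

Lemma V_nmul n a : V a -> V (n%:R * a).
Proof. exact: V_M. Qed.

Lemma V_natdiv n a : V (n.+1%:R * a) -> V a.
Proof. by rewrite mulr_natl; exact: V_div. Qed.

Lemma V_B a b : V a -> V b -> V (a - b).
Proof. by move=> Va Vb; apply: V_D => //; exact: V_N. Qed.

(* Weight vectors of the adjoint module: z0, ..., z5 have weights 3a1 + 2a2,
   3a1 + a2, 2a1 + a2, a1 + a2, a2 and a1, where a1 and a2 are the simple roots;
   k and l have weight 0; z7, y, x, w, zb and zc have weights -a2, -a1,
   -a1 - a2, -2a1 - a2, -3a1 - a2 and -3a1 - 2a2. *)
Variables z0 z1 z2 z3 z4 z5 k l z7 y x w zb zc : A.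
Hypothesis Lz0 : L z0.
Hypothesis E1z0 : E1 z0 = 0.
Hypothesis E2z0 : E2 z0 = 0.
Hypothesis weight_z0 : weight 0 1 z0.
Hypothesis F2z0 : F2 z0 = z1.
Hypothesis F1z1 : F1 z1 = 3 * z2.
Hypothesis F1z2 : F1 z2 = 2 * z3.
Hypothesis F1z3 : F1 z3 = z4.
Hypothesis F2z3 : F2 z3 = z5.
Hypothesis F2z4 : F2 z4 = k.
Hypothesis F1z5 : F1 z5 = l.
Hypothesis F2k : F2 k = 2 * z7.
Hypothesis Fy : F1 k - F1 l = y.
Hypothesis F2y : F2 y = x.
Hypothesis F1x : F1 x = 2 * w.
Hypothesis F1w : F1 w = zb.
Hypothesis F2zb : F2 zb = zc.

Lemma V_z1 : V z1. Proof. by rewrite -F2z0; exact: V_F. Qed.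
Lemma V_z2 : V z2.
Proof. by apply: (@V_natdiv 2); rewrite -F1z1; exact/V_F/V_L/V_z1. Qed.
Lemma V_z3 : V z3.
Proof. by apply: (@V_natdiv 1); rewrite -F1z2; exact/V_F/V_L/V_z2. Qed.
Lemma V_z4 : V z4. Proof. by rewrite -F1z3; exact/V_F/V_L/V_z3. Qed.
Lemma V_z5 : V z5. Proof. by rewrite -F2z3; exact/V_F/V_L/V_z3. Qed.
Lemma V_k : V k. Proof. by rewrite -F2z4; exact/V_F/V_L/V_z4. Qed.
Lemma V_l : V l. Proof. by rewrite -F1z5; exact/V_F/V_L/V_z5. Qed.
Lemma V_z7 : V z7.
Proof. by apply: (@V_natdiv 1); rewrite -F2k; exact/V_F/V_L/V_k. Qed.
Lemma V_y : V y.
Proof. by rewrite -Fy; apply: V_B; apply/V_F/V_L; [exact: V_k|exact: V_l]. Qed.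
Lemma V_x : V x. Proof. by rewrite -F2y; exact/V_F/V_L/V_y. Qed.
Lemma V_w : V w.
Proof. by apply: (@V_natdiv 1); rewrite -F1x; exact/V_F/V_L/V_x. Qed.
Lemma V_zb : V zb. Proof. by rewrite -F1w; exact/V_F/V_L/V_w. Qed.
Lemma V_zc : V zc. Proof. by rewrite -F2zb; exact/V_F/V_L/V_zb. Qed.

Lemma weight_z1 : weight 3 (-1) z1.
Proof. by rewrite -F2z0; exact: weightF2 weight_z0. Qed.
Lemma weight_z2 : weight 1 0 z2.
Proof. by apply: (@weight_div _ _ 2); rewrite -F1z1; exact: weightF1 weight_z1.
  Qed.
Lemma weight_z3 : weight (-1) 1 z3.
Proof. by apply: (@weight_div _ _ 1); rewrite -F1z2; exact: weightF1 weight_z2.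
  Qed.
Lemma weight_z4 : weight (-3) 2 z4.
Proof. by rewrite -F1z3; exact: weightF1 weight_z3. Qed.
Lemma weight_z5 : weight 2 (-1) z5.
Proof. by rewrite -F2z3; exact: weightF2 weight_z3. Qed.
Lemma weight_k : weight 0 0 k.
Proof. by rewrite -F2z4; exact: weightF2 weight_z4. Qed.
Lemma weight_l : weight 0 0 l.
Proof. by rewrite -F1z5; exact: weightF1 weight_z5. Qed.
Lemma weight_z7 : weight 3 (-2) z7.
Proof. by apply: (@weight_div _ _ 1); rewrite -F2k; exact: weightF2 weight_k.
  Qed.
Lemma weight_y : weight (-2) 1 y.
Proof.
rewrite -Fy; apply: weightD; first exact: weightF1 weight_k.
by apply: weightN; exact: weightF1 weight_l.
Qed.
Lemma weight_x : weight 1 (-1) x.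
Proof. by rewrite -F2y; exact: weightF2 weight_y. Qed.
Lemma weight_w : weight (-1) 0 w.
Proof. by apply: (@weight_div _ _ 1); rewrite -F1x; exact: weightF1 weight_x.
  Qed.
Lemma weight_zb : weight (-3) 1 zb.
Proof. by rewrite -F1w; exact: weightF1 weight_w. Qed.
Lemma weight_zc : weight 0 (-1) zc.
Proof. by rewrite -F2zb; exact: weightF2 weight_zb. Qed.

(** The pattern for every vanishing or proportionality in the table of the action: the candidate is
    a weight vector in [V], commuting the E_i inwards shows that they annihilate it, and so it is
    zero. *)
Lemma F1z0 : F1 z0 = 0.
Proof.
apply: (singular_weight (V_F _ Lz0) (weightF1 weight_z0)).
- by rewrite EF11 E1z0 F10 weight_z0.1; ring.
- by rewrite EF21 E2z0 F10.
Qed.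

Lemma E1z1 : E1 z1 = 0.
Proof. by rewrite -F2z0 EF12 E1z0 F20. Qed.

Lemma E2z1 : E2 z1 = z0.
Proof. by rewrite -F2z0 EF22 E2z0 F20 weight_z0.2; ring. Qed.

Lemma F2z1 : F2 z1 = 0.
Proof.
apply: (singular_weight (V_F _ (V_L V_z1)) (weightF2 weight_z1)).
- by rewrite EF12 E1z1 F20.
- by rewrite EF22 E2z1 F2z0 weight_z1.2; ring.
Qed.

Lemma E1z2 : E1 z2 = z1.
Proof. by apply: (@natcancel 2); rewrite -E1n -F1z1 EF11 E1z1 F10 weight_z1.1;
  ring. Qed.

Lemma E2z2 : E2 z2 = 0.
Proof. by apply: (@natcancel 2); rewrite -E2n -F1z1 EF21 E2z1 F1z0 mulr0. Qed.

Lemma F2z2 : F2 z2 = 0.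
Proof.
apply: (singular_weight (V_F _ (V_L V_z2)) (weightF2 weight_z2)).
- by rewrite EF12 E1z2 F2z1.
- by rewrite EF22 E2z2 F20 weight_z2.2; ring.
Qed.

Lemma E1z3 : E1 z3 = 2 * z2.
Proof. by apply: (@natcancel 1); rewrite -E1n -F1z2 EF11 E1z2 F1z1 weight_z2.1;
  ring. Qed.

Lemma E2z3 : E2 z3 = 0.
Proof. by apply: (@natcancel 1); rewrite -E2n -F1z2 EF21 E2z2 F10 mulr0. Qed.

Lemma E1z4 : E1 z4 = 3 * z3.
Proof. by rewrite -F1z3 EF11 E1z3 F1n F1z2 weight_z3.1; ring. Qed.

Lemma E2z4 : E2 z4 = 0.
Proof. by rewrite -F1z3 EF21 E2z3 F10. Qed.

Lemma E1z5 : E1 z5 = 0.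
Proof. by rewrite -F2z3 EF12 E1z3 F2n F2z2 mulr0. Qed.

Lemma E2z5 : E2 z5 = z3.
Proof. by rewrite -F2z3 EF22 E2z3 F20 weight_z3.2; ring. Qed.

Lemma F1z4 : F1 z4 = 0.
Proof.
apply: (singular_weight (V_F _ (V_L V_z4)) (weightF1 weight_z4)).
- by rewrite EF11 E1z4 F1n F1z3 weight_z4.1; ring.
- by rewrite EF21 E2z4 F10.
Qed.

Lemma F2z5 : F2 z5 = 0.
Proof.
apply: (singular_weight (V_F _ (V_L V_z5)) (weightF2 weight_z5)).
- by rewrite EF12 E1z5 F20.
- by rewrite EF22 E2z5 F2z3 weight_z5.2; ring.
Qed.

Lemma E1k : E1 k = 3 * z5.
Proof. by rewrite -F2z4 EF12 E1z4 F2n F2z3. Qed.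

Lemma E2k : E2 k = 2 * z4.
Proof. by rewrite -F2z4 EF22 E2z4 F20 weight_z4.2; ring. Qed.

Lemma E1l : E1 l = 2 * z5.
Proof. by rewrite -F1z5 EF11 E1z5 F10 weight_z5.1; ring. Qed.

Lemma E2l : E2 l = z4.
Proof. by rewrite -F1z5 EF21 E2z5 F1z3. Qed.

Lemma E1z7 : E1 z7 = 0.
Proof. by apply: (@natcancel 1); rewrite -E1n -F2k EF12 E1k F2n F2z5 !mulr0.
  Qed.

Lemma E2z7 : E2 z7 = k.
Proof. by apply: (@natcancel 1); rewrite -E2n -F2k EF22 E2k F2n F2z4
  weight_k.2; ring. Qed.

Lemma F2l : F2 l = z7.
Proof.
apply/eqP; rewrite -subr_eq0; apply/eqP.
apply: (singular_weight (V_B (V_F _ (V_L V_l)) V_z7) (weightD (weightF2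
  weight_l) (weightN weight_z7))).
- by rewrite E1D E1N EF12 E1l F2n F2z5 E1z7; ring.
- by rewrite E2D E2N EF22 E2l F2z4 weight_l.2 E2z7; ring.
Qed.

Lemma E1F1k : E1 (F1 k) = 3 * l.
Proof. by rewrite EF11 E1k F1n F1z5 weight_k.1; ring. Qed.

Lemma E1F1l : E1 (F1 l) = 2 * l.
Proof. by rewrite EF11 E1l F1n F1z5 weight_l.1; ring. Qed.

Lemma E2F1k : E2 (F1 k) = 0.
Proof. by rewrite EF21 E2k F1n F1z4 mulr0. Qed.

Lemma E2F1l : E2 (F1 l) = 0.
Proof. by rewrite EF21 E2l F1z4. Qed.

(** Both vectors have the weight of [y], and [E1] sends them to 3 l and 2 l, which fixes the ratio.
    Taking [y] as their difference keeps the structure constants integral. *)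
Lemma F1kl : 2 * F1 k = 3 * F1 l.
Proof.
apply/eqP; rewrite -subr_eq0; apply/eqP.
apply: (singular_weight (V_B (V_nmul 2 (V_F _ (V_L V_k))) (V_nmul 3 (V_F _ (V_L
  V_l))))
  (weightD (weight_nat 2 (weightF1 weight_k)) (weightN (weight_nat 3 (weightF1
    weight_l))))).
- by rewrite E1D E1N !E1n E1F1k E1F1l; ring.
- by rewrite E2D E2N !E2n E2F1k E2F1l; ring.
Qed.

Lemma F1k : F1 k = 3 * y.
Proof.
have -> : 3 * y = F1 k + (2 * F1 k - 3 * F1 l) by rewrite -Fy; ring.
by rewrite F1kl subrr addr0.
Qed.

Lemma F1l : F1 l = 2 * y.
Proof.
have -> : 2 * y = F1 l + (2 * F1 k - 3 * F1 l) by rewrite -Fy; ring.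
by rewrite F1kl subrr addr0.
Qed.

Lemma E1y : E1 y = l.
Proof. by rewrite -Fy E1D E1N E1F1k E1F1l; ring. Qed.

Lemma E2y : E2 y = 0.
Proof. by rewrite -Fy E2D E2N E2F1k E2F1l subrr. Qed.

Lemma F1y : F1 y = 0.
Proof.
apply: (singular_weight (V_F _ (V_L V_y)) (weightF1 weight_y)).
- by rewrite EF11 E1y F1l weight_y.1; ring.
- by rewrite EF21 E2y F10.
Qed.

Lemma E1x : E1 x = z7.
Proof. by rewrite -F2y EF12 E1y F2l. Qed.

Lemma E2x : E2 x = y.
Proof. by rewrite -F2y EF22 E2y F20 weight_y.2; ring. Qed.

Lemma F1z7 : F1 z7 = 3 * x.
Proof.
apply/eqP; rewrite -subr_eq0; apply/eqP.
apply: (singular_weight (V_B (V_F _ (V_L V_z7)) (V_nmul 3 V_x))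
  (weightD (weightF1 weight_z7) (weightN (weight_nat 3 weight_x)))).
- by rewrite E1D E1N E1n EF11 E1z7 F10 weight_z7.1 E1x; ring.
- by rewrite E2D E2N E2n EF21 E2z7 F1k E2x; ring.
Qed.

Lemma F2z7 : F2 z7 = 0.
Proof.
apply: (singular_weight (V_F _ (V_L V_z7)) (weightF2 weight_z7)).
- by rewrite EF12 E1z7 F20.
- by rewrite EF22 E2z7 F2k weight_z7.2; ring.
Qed.

Lemma F2x : F2 x = 0.
Proof.
apply: (singular_weight (V_F _ (V_L V_x)) (weightF2 weight_x)).
- by rewrite EF12 E1x F2z7.
- by rewrite EF22 E2x F2y weight_x.2; ring.
Qed.

Lemma E1w : E1 w = 2 * x.
Proof. by apply: (@natcancel 1); rewrite -E1n -F1x EF11 E1x F1z7 weight_x.1;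
  ring. Qed.

Lemma E2w : E2 w = 0.
Proof. by apply: (@natcancel 1); rewrite -E2n -F1x EF21 E2x F1y mulr0. Qed.

Lemma F2w : F2 w = 0.
Proof.
apply: (singular_weight (V_F _ (V_L V_w)) (weightF2 weight_w)).
- by rewrite EF12 E1w F2n F2x mulr0.
- by rewrite EF22 E2w F20 weight_w.2; ring.
Qed.

Lemma E1zb : E1 zb = 3 * w.
Proof. by rewrite -F1w EF11 E1w F1n F1x weight_w.1; ring. Qed.

Lemma E2zb : E2 zb = 0.
Proof. by rewrite -F1w EF21 E2w F10. Qed.

Lemma F1zb : F1 zb = 0.
Proof.
apply: (singular_weight (V_F _ (V_L V_zb)) (weightF1 weight_zb)).
- by rewrite EF11 E1zb F1n F1w weight_zb.1; ring.
- by rewrite EF21 E2zb F10.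
Qed.

Lemma E1zc : E1 zc = 0.
Proof. by rewrite -F2zb EF12 E1zb F2n F2w mulr0. Qed.

Lemma E2zc : E2 zc = zb.
Proof. by rewrite -F2zb EF22 E2zb F20 weight_zb.2; ring. Qed.

Lemma F1zc : F1 zc = 0.
Proof.
apply: (singular_weight (V_F _ (V_L V_zc)) (weightF1 weight_zc)).
- by rewrite EF11 E1zc F10 weight_zc.1; ring.
- by rewrite EF21 E2zc F1zb.
Qed.

Lemma F2zc : F2 zc = 0.
Proof.
apply: (singular_weight (V_F _ (V_L V_zc)) (weightF2 weight_zc)).
- by rewrite EF12 E1zc F20.
- by rewrite EF22 E2zc F2zb weight_zc.2; ring.
Qed.

Let F1E := (F1z0, F1z1, F1z2, F1z3, F1z4, F1z5, F1k, F1l, F1z7, F1y, F1x, F1w,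
  F1zb, F1zc, F1n, F1D, F1N, FM r1).
Let F2E := (F2z0, F2z1, F2z2, F2z3, F2z4, F2z5, F2k, F2l, F2z7, F2y, F2x, F2w,
  F2zb, F2zc, F2n, F2D, F2N, FM r2).

(** The products of weight 2 omega_1 are z0 z5, z1 z3 and z2^2; annihilation by [E1] ties the
    coefficients of the last two together, annihilation by [E2] those of the first two. *)
Lemma quadric : - (z0 * z5) + z1 * z3 - z2 * z2 = 0.
Proof.
have Vz0z5 := V_M Lz0 V_z5; have Vz1z3 := V_M (V_L V_z1) V_z3.
have Vz2z2 := V_M (V_L V_z2) V_z2.
apply: (singular_weight (c1 := 2) (c2 := 0)).
- by apply: V_B => //; apply: V_D => //; exact: V_N.
- apply: weightD; last exact/weightN/(weightM weight_z2 weight_z2).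
  by apply: weightD; [exact/weightN/(weightM weight_z0 weight_z5)|exact:
    (weightM weight_z1 weight_z3)].
- by rewrite !(E1D, E1N, EM r1) E1z0 E1z1 E1z2 E1z3 E1z5; ring.
- by rewrite !(E2D, E2N, EM r2) E2z0 E2z1 E2z2 E2z3 E2z5; ring.
Qed.

(* Up to a constant factor, the left-hand side of quadric_i...j is
   F_i (... (F_j q)), where q is the left-hand side of quadric. *)
Lemma quadric_1 : - (z0 * l) + z1 * z4 - z2 * z3 = 0.
Proof.
transitivity (F1 (- (z0 * z5) + z1 * z3 - z2 * z2)); last by rewrite quadric
  F10.
rewrite !F1E; ring.
Qed.

Lemma quadric_11 : - (z0 * y) + z2 * z4 - z3 * z3 = 0.
Proof.
apply: (@natcancel 1); rewrite mulr0.
transitivity (F1 (- (z0 * l) + z1 * z4 - z2 * z3)); last by rewrite quadric_1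
  F10.
rewrite !F1E; ring.
Qed.

Lemma quadric_21 : - (z0 * z7) + z1 * k - z1 * l - z2 * z5 = 0.
Proof.
transitivity (F2 (- (z0 * l) + z1 * z4 - z2 * z3)); last by rewrite quadric_1
  F20.
rewrite !F2E; ring.
Qed.

Lemma quadric_121 : - (3 * (z0 * x)) + z1 * y + 3 * (z2 * k) - 4 * (z2 * l) - 2
  * (z3 * z5) = 0.
Proof.
transitivity (F1 (- (z0 * z7) + z1 * k - z1 * l - z2 * z5)); last by rewrite
  quadric_21 F10.
rewrite !F1E; ring.
Qed.

Lemma quadric_211 : - (z0 * x) - z1 * y + z2 * k - 2 * (z3 * z5) = 0.
Proof.
transitivity (F2 (- (z0 * y) + z2 * z4 - z3 * z3)); last by rewrite quadric_11
  F20.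
rewrite !F2E; ring.
Qed.

Lemma quadric_1121 : - (3 * (z0 * w)) + 2 * (z2 * y) + 3 * (z3 * k) - 5 * (z3 *
  l) - z4 * z5 = 0.
Proof.
apply: (@natcancel 1); rewrite mulr0.
transitivity (F1 (- (3 * (z0 * x)) + z1 * y + 3 * (z2 * k) - 4 * (z2 * l) - 2 *
  (z3 * z5))); last by rewrite quadric_121 F10.
rewrite !F1E; ring.
Qed.

Lemma quadric_1211 : - (z0 * w) + z3 * k - z3 * l - z4 * z5 = 0.
Proof.
apply: (@natcancel 1); rewrite mulr0.
transitivity (F1 (- (z0 * x) - z1 * y + z2 * k - 2 * (z3 * z5))); last by
  rewrite quadric_211 F10.
rewrite !F1E; ring.
Qed.

Lemma quadric_11211 : - (z0 * zb) + z3 * y + z4 * k - 2 * (z4 * l) = 0.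
Proof.
transitivity (F1 (- (z0 * w) + z3 * k - z3 * l - z4 * z5)); last by rewrite
  quadric_1211 F10.
rewrite !F1E; ring.
Qed.

Lemma quadric_21121 : - (3 * (z1 * w)) + 2 * (z2 * x) + z3 * z7 + 2 * (z5 * k)
  - 5 * (z5 * l) = 0.
Proof.
transitivity (F2 (- (3 * (z0 * w)) + 2 * (z2 * y) + 3 * (z3 * k) - 5 * (z3 * l)
  - z4 * z5)); last by rewrite quadric_1121 F20.
rewrite !F2E; ring.
Qed.

Lemma quadric_21211 : - (z1 * w) + z3 * z7 - z5 * l = 0.
Proof.
transitivity (F2 (- (z0 * w) + z3 * k - z3 * l - z4 * z5)); last by rewrite
  quadric_1211 F20.
rewrite !F2E; ring.
Qed.

Lemma quadric_121121 : 2 * (k * l) - 5 * (l * l) - 3 * (z1 * zb) - 5 * (z2 * w)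
  + 7 * (z3 * x) + z4 * z7 - 4 * (z5 * y) = 0.
Proof.
transitivity (F1 (- (3 * (z1 * w)) + 2 * (z2 * x) + z3 * z7 + 2 * (z5 * k) - 5
  * (z5 * l))); last by rewrite quadric_21121 F10.
rewrite !F1E; ring.
Qed.

Lemma quadric_121211 : - (l * l) - z1 * zb - 3 * (z2 * w) + 3 * (z3 * x) + z4 *
  z7 - 2 * (z5 * y) = 0.
Proof.
transitivity (F1 (- (z1 * w) + z3 * z7 - z5 * l)); last by rewrite
  quadric_21211 F10.
rewrite !F1E; ring.
Qed.

Lemma quadric_211211 : k * k - 2 * (k * l) - z0 * zc - z1 * zb + z3 * x + z5 *
  y = 0.
Proof.
transitivity (F2 (- (z0 * zb) + z3 * y + z4 * k - 2 * (z4 * l))); last by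
  rewrite quadric_11211 F20.
rewrite !F2E; ring.
Qed.

Lemma quadric_2211211 : k * z7 - 2 * (l * z7) - z1 * zc + z5 * x = 0.
Proof.
apply: (@natcancel 1); rewrite mulr0.
transitivity (F2 (k * k - 2 * (k * l) - z0 * zc - z1 * zb + z3 * x + z5 * y));
  last by rewrite quadric_211211 F20.
rewrite !F2E; ring.
Qed.

Lemma exchange_b : z1 * z3 = z5 * z0 + z2 * z2.
Proof. by apply/eqP; rewrite -subr_eq0 -quadric; apply/eqP; ring. Qed.

Lemma cubic_a :
  z4 * (z3 * z2 - (2 * l - k) * z0) = zb * z0 * z0 + z3 * z3 * z3.
Proof.
apply/eqP; rewrite -subr_eq0; apply/eqP.
(* The two zeros are placeholders for [quadric_11] and [quadric_11211], which the backward rewrites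
   put in; the cubic is z3 times the one plus z0 times the other. *)
transitivity (z3 * 0 + z0 * 0 : A); last by rewrite !mulr0 addr0.
rewrite -{1}quadric_11 -quadric_11211; ring.
Qed.

(* The coefficients solve the linear system that expresses this cubic, of weight
   0, in the ideal generated by the quadrics. *)
Lemma cubic_c : zb * (z2 * z5 - z1 * (2 * l - k)) =
  (z3 * z2 - (2 * l - k) * z0) * zc + (2 * l - k) ^+ 3.
Proof.
(* Doubling makes the coefficients of the combination integral. *)
apply: (@natcancel 1); apply/eqP; rewrite -subr_eq0; apply/eqP.
transitivity (
  (2 * zc) * (- (z0 * l) + z1 * z4 - z2 * z3) +
  (- (2 * zb)) * (- (z0 * z7) + z1 * k - z1 * l - z2 * z5) +
  (- (7 * w)) * (- (3 * (z0 * x)) + z1 * y + 3 * (z2 * k) - 4 * (z2 * l) - 2 *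
    (z3 * z5)) +
  (7 * w) * (- (z0 * x) - z1 * y + z2 * k - 2 * (z3 * z5)) +
  (6 * x) * (- (3 * (z0 * w)) + 2 * (z2 * y) + 3 * (z3 * k) - 5 * (z3 * l) - z4
    * z5) +
  (- (4 * x)) * (- (z0 * w) + z3 * k - z3 * l - z4 * z5) +
  (2 * z7) * (- (z0 * zb) + z3 * y + z4 * k - 2 * (z4 * l)) +
  (- (6 * y)) * (- (3 * (z1 * w)) + 2 * (z2 * x) + z3 * z7 + 2 * (z5 * k) - 5 *
    (z5 * l)) +
  (4 * y) * (- (z1 * w) + z3 * z7 - z5 * l) +
  (- (k) + 2 * l) * (2 * (k * l) - 5 * (l * l) - 3 * (z1 * zb) - 5 * (z2 * w) +
    7 * (z3 * x) + z4 * z7 - 4 * (z5 * y)) +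
  (6 * l - 3 * k) * (- (l * l) - z1 * zb - 3 * (z2 * w) + 3 * (z3 * x) + z4 *
    z7 - 2 * (z5 * y)) +
  (2 * k - 6 * l) * (k * k - 2 * (k * l) - z0 * zc - z1 * zb + z3 * x + z5 * y)
    +
  (2 * z4) * (k * z7 - 2 * (l * z7) - z1 * zc + z5 * x)).
  by ring.
by rewrite quadric_1 quadric_21 quadric_121 quadric_211 quadric_1121
  quadric_1211 quadric_11211 quadric_21121 quadric_21211 quadric_121121
  quadric_121211 quadric_211211 quadric_2211211 !mulr0 !addr0.
Qed.

Hypothesis z0_neq0 : z0 != 0.

(** Raising operators send each vector of the chain to a nonzero multiple of the previous one, so
    nonvanishing descends from z0. *)
Lemma z1_neq0 : z1 != 0.
Proof. by apply: contra_neq z0_neq0 => z1_0; rewrite -E2z1 z1_0 E20. Qed.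

Lemma z2_neq0 : z2 != 0.
Proof. by apply: contra_neq z1_neq0 => z2_0; rewrite -E1z2 z2_0 E10. Qed.

Lemma z3_neq0 : z3 != 0.
Proof.
apply: contra_neq z2_neq0 => z3_0; apply: (@natcancel 1).
by rewrite -E1z3 z3_0 E10 mulr0.
Qed.

Lemma z4_neq0 : z4 != 0.
Proof.
apply: contra_neq z3_neq0 => z4_0; apply: (@natcancel 2).
by rewrite -E1z4 z4_0 E10 mulr0.
Qed.

(** Applying [E2] and then [E1] gives 3 z2^2 up to the vanishing quadric. *)
Lemma exchange_var_neq0 : z2 * z5 - z1 * (2 * l - k) != 0.
Proof.
have z22 : z2 * z2 != 0 by rewrite mulf_neq0 ?z2_neq0.
apply: contra_neq z22 => a0; apply: (@natcancel 2); rewrite mulr0.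
transitivity (E1 (E2 (z2 * z5 - z1 * (2 * l - k)))); last first.
  by rewrite a0 E20 E10.
rewrite !(E2n, E2D, E2N, EM r2) E2z1 E2z2 E2z5 E2l E2k.
rewrite !(E1n, E1D, E1N, EM r1) E10 E1z0 E1z1 E1z2 E1z3 E1z4 E1z5 E1l E1k.
transitivity (3 * (z2 * z2) + (- (z0 * z5) + z1 * z3 - z2 * z2)); last by ring.
by rewrite quadric addr0.
Qed.

(** What the lifts of reflections need along the reduced word of w_0: the extremal vectors z0, z1,
    z4, z7, zb, zc start strings of lengths 1, 3, 2, 3, 1, 0. *)
Lemma adjoint_strings :
  [/\ F2 z1 = 0, [/\ E1 z1 = 0, H1 z1 = z1 *~ 3 & F1 z4 = 0],
      [/\ E2 z4 = 0, H2 z4 = z4 *~ 2 & F2 z7 = 0],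
      [/\ E1 z7 = 0, H1 z7 = z7 *~ 3, F1 z7 = 3 * x & F1 zb = 0] &
      [/\ E2 zb = 0, H2 zb = zb *~ 1 & F2 zc = 0] /\
      [/\ E1 zc = 0, H1 zc = zc *~ 0 & F1 zc = 0]].
Proof.
split; rewrite ?(F2z1, E1z1, F1z4, E2z4, F2z7, E1z7, F1z7, F1zb, E2zb) //.
- by case: weight_z1.
- by case: weight_z4.
- by case: weight_z7.
- by rewrite F2zc E1zc F1zc; split; split=> //; [case: weight_zb|case:
    weight_zc].
Qed.

Lemma adjoint_relations :
  [/\ z1 * z3 = z5 * z0 + z2 * z2,
      z4 * (z3 * z2 - (2 * l - k) * z0) = zb * z0 * z0 + z3 * z3 * z3,
      zb * (z2 * z5 - z1 * (2 * l - k)) =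
        (z3 * z2 - (2 * l - k) * z0) * zc + (2 * l - k) ^+ 3 &
      [&& z1 != 0, z3 != 0, z4 != 0 & z2 * z5 - z1 * (2 * l - k) != 0]].
Proof.
split; [exact: exchange_b | exact: cubic_a | exact: cubic_c |].
by rewrite z1_neq0 z3_neq0 z4_neq0 exchange_var_neq0.
Qed.

End AdjointModule.

(** * The exchange relations *)

Section MinorIdentities.
Variables (K : numFieldType) (n : nat) (D : G2_rep K n).
Variable phi : 'I_2 -> 'M[K]_2 -> G2_group D.
Hypothesis phi_hom : forall i, is_SL2_hom i (phi i).
Variable Delta2 : regfun D.
Hypothesis Delta2_minor : is_principal_minor phi r2 Delta2.

Local Notation Delta := (minor2 phi Delta2).
Local Notation F21 := (F21 phi Delta2).
Local Notation F11 := (F11 phi Delta2).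
Local Notation F10 := (F10 phi Delta2).
Local Notation F00 := (F00 phi Delta2).
Local Notation E := (@edag K n D).
Local Notation F := (@fdag K n D).
Local Notation H := (@hdag K n D).
Local Notation L := (@left_Nminus_invariant K n D).

Definition invariant_vanishing1 (f : regfun D) := L f /\ f (G2_one D) = 0.

Local Notation V := invariant_vanishing1.

Let natA m : m.+1%:R != 0 :> regfun D.
Proof.
apply/eqP => /regfun_eqP/(_ (G2_one D)) /eqP.
rewrite -[m.+1%:R]/((1 : regfun D) *+ m.+1) -scaler_nat.
by rewrite regfun_scaleE [X in _ * X](_ : _ = 1) // mulr1 (_ : (0 : regfun D) _
  = 0) // pnatr_eq0.
Qed.

Let L_nat m : L m%:R.
Proof.
by move=> u x y _ _; rewrite -[m%:R]/((1 : regfun D) *+ m) -scaler_nat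
  !regfun_scaleE.
Qed.

Let L_N1 : L (-1). Proof. by []. Qed.

Let V_F i f : L f -> V (F i f).
Proof. by move=> Lf; split; [exact: left_invariant_fdag|exact:
  left_invariant_fdag1]. Qed.

Let V_D f g : V f -> V g -> V (f + g).
Proof.
move=> [Lf f1] [Lg g1]; split; first exact: left_invariantD.
by rewrite regfun_addE f1 g1 addr0.
Qed.

Let V_M f g : L f -> V g -> V (f * g).
Proof.
move=> Lf [Lg g1]; split; first exact: left_invariantM.
by rewrite regfun_mulE g1 mulr0.
Qed.

Let V_div m f : V (f *+ m.+1) -> V f.
Proof.
have m0 : m.+1%:R != 0 :> K by rewrite pnatr_eq0.
rewrite -scaler_nat => -[Lf /eqP]; rewrite regfun_scaleE mulf_eq0 (negbTE m0).
move=> /eqP f1; split=> // u x y Nu yE; apply: (mulfI m0).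
by rewrite -!regfun_scaleE; exact: Lf yE.
Qed.

Let sing f (c : 'I_2 -> int) : V f -> (forall i, E i f = 0) ->
  (forall i, H i f = f *~ c i) -> f = 0.
Proof. by move=> [Lf f1] Ef Hf; exact: singular_eq0 Lf Ef Hf f1. Qed.

Lemma minor2_nil : Delta [::] = Delta2.
Proof.
apply/regfun_eqP => x; rewrite -[LHS]/(Delta2 (G2_mul x (G2_one D))).
by apply: regfun_sval; rewrite /= mulr1.
Qed.

Lemma minor2_cons i s : Delta (i :: s) = rtrans (sbar phi i) (Delta s).
Proof.
apply/regfun_eqP => x.
rewrite -[LHS]/(Delta2 (G2_mul x (wbar phi (i :: s)))).
rewrite -[RHS]/(Delta2 (G2_mul (G2_mul x (sbar phi i)) (wbar phi s))).
by apply: regfun_sval; rewrite /= mulrA.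
Qed.

(** The nonzero functions are the variables that get mutated. The relations are those of mu_3 on the
    GLS seed, of mu_3 on the other seed and of mu_1, cleared of denominators. *)
Lemma minor_seed_relations :
  [/\ Delta [:: r2] != 0, Delta [:: r1; r2] != 0, F11 != 0 &
      F21 * F10 - Delta [:: r2] * F00 != 0] /\
  [/\ (F21 * F10 - Delta [:: r2] * F00) * Delta2 + F21 ^+ 3 =
        (F11 * F21 - F00 * Delta2) * Delta [:: r2],
      Delta [:: r1; r2; r1; r2] * Delta2 ^+ 2 + F11 ^+ 3 =
        (F11 * F21 - F00 * Delta2) * Delta [:: r1; r2] &
      (F11 * F21 - F00 * Delta2) * Delta w0 + F00 ^+ 3 =
        Delta [:: r1; r2; r1; r2] * (F21 * F10 - Delta [:: r2] * F00)].
Proof.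
pose z1 := F r2 Delta2; pose z2 := 3^-1 *: F r1 z1; pose z3 := 2^-1 *: F r1 z2.
pose z4 := F r1 z3; pose z5 := F r2 z3; pose k := F r2 z4; pose l := F r1 z5.
pose z7 := 2^-1 *: F r2 k; pose y := F r1 k - F r1 l; pose x := F r2 y.
pose w := 2^-1 *: F r1 x; pose zb := F r1 w; pose zc := F r2 zb.
have scalek (m : nat) (f : regfun D) : f = m.+1%:R * (m.+1%:R^-1 *: f).
  by rewrite mulr_natl -scaler_nat scalerA mulfV ?pnatr_eq0 // scale1r.
have ED i := let: And3 d _ _ := edag_derivation D i in d.
have EM i := let: And3 _ d _ := edag_derivation D i in d.
have FD i := let: And3 d _ _ := fdag_derivation D i in d.
have FM i := let: And3 _ d _ := fdag_derivation D i in d.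
have FZ i := let: And3 _ _ d := fdag_derivation D i in d.
have HD i := let: And3 d _ _ := hdag_derivation D i in d.
have HM i := let: And3 _ d _ := hdag_derivation D i in d.
have EF := @edag_fdag K n D; have HF := @hdag_fdag K n D.
have VL f (Vf : V f) : L f by case: Vf.
have Lz0 := left_invariant_principal_minor phi_hom Delta2_minor.
have E1z0 := edag_principal_minor phi_hom Delta2_minor r1.
have E2z0 := edag_principal_minor phi_hom Delta2_minor r2.
have H2z0 := hdag2_principal_minor phi_hom Delta2_minor.
have wz0 : weight H 0 1 Delta2.
  by split; rewrite ?(hdag1_principal_minor phi_hom Delta2_minor) // H2z0
    mulr1z.
have z0n0 : Delta2 != 0.
  apply/eqP => z0_0; have := principal_minor1 phi_hom Delta2_minor.
  by rewrite z0_0 => /esym/eqP; rewrite oner_eq0.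
have F1z1 : F r1 z1 = 3 * z2 by exact: (scalek 2).
have F1z2 : F r1 z2 = 2 * z3 by exact: (scalek 1).
have F2k : F r2 k = 2 * z7 by exact: (scalek 1).
have F1x : F r1 x = 2 * w by exact: (scalek 1).
have [F2z1 [E1z1 H1z1 F1z4] [E2z4 H2z4 F2z7] [E1z7 H1z7 F1z7 F1zb]
    [[E2zb H2zb F2zc] [E1zc H1zc F1zc]]] :=
  adjoint_strings (A := regfun D) (V := V) (z1 := z1) (z4 := z4) (z5 := z5) (k
    := k)
    (l := l) (y := y) (x := x) (zb := zb) (zc := zc)
    natA ED FD HD EF HF VL V_F V_D V_M L_nat L_N1 V_div sing Lz0 E1z0 E2z0 wz0
      erefl F1z1 F1z2 erefl erefl erefl erefl F2k erefl
    erefl F1x erefl erefl.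
have [relb rela relc /and4P[z1n0 z3n0 z4n0 An0]] :=
  adjoint_relations (A := regfun D) (V := V) (z1 := z1) (z4 := z4) (z5 := z5)
    (k := k)
    (l := l) (y := y) (x := x) (zb := zb) (zc := zc)
    natA ED EM FD FM HD HM EF HF VL V_F V_D V_M L_nat L_N1 V_div
    sing Lz0 E1z0 E2z0 wz0 erefl F1z1 F1z2 erefl erefl erefl erefl F2k erefl
    erefl F1x erefl erefl z0n0.
have sbar1 i (f : regfun D) : E i f = 0 -> H i f = f *~ 1 ->
    F i (F i f) = 0 -> rtrans (sbar phi i) f = F i f.
  move=> Ef Hf Ff; rewrite (rtrans_sbar phi_hom (m := 1)) ?Hf ?scale1r //.
  by rewrite invr1 scale1r.
have sbar2 i (f : regfun D) : E i f = 0 -> H i f = f *~ 2 ->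
    F i (F i (F i f)) = 0 -> rtrans (sbar phi i) f = 2^-1 *: F i (F i f).
  by move=> Ef Hf Ff; rewrite (rtrans_sbar phi_hom (m := 2)) // Hf scaler_nat.
have sbar3 i (f : regfun D) : E i f = 0 -> H i f = f *~ 3 ->
    F i (F i (F i (F i f))) = 0 ->
    rtrans (sbar phi i) f = 6^-1 *: F i (F i (F i f)).
  by move=> Ef Hf Ff; rewrite (rtrans_sbar phi_hom (m := 3)) // Hf scaler_nat.
have sbar0 i (f : regfun D) : E i f = 0 -> H i f = f *~ 0 ->
    F i f = 0 -> rtrans (sbar phi i) f = f.
  move=> Ef Hf Ff; rewrite (rtrans_sbar phi_hom (m := 0)) //.
    by rewrite invr1 scale1r.
  by rewrite Hf scale0r.
have Fnat i m (f : regfun D) : F i (m%:R * f) = m%:R * F i f.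
  by rewrite !mulr_natl -(scaler_nat m f) -(scaler_nat m (F i f)) FZ.
have D1 : Delta [:: r2] = z1.
  by rewrite minor2_cons minor2_nil sbar1.
have D2 : Delta [:: r1; r2] = z4.
  have F3 : F r1 (F r1 (F r1 z1)) = 6 *: z4.
    by rewrite F1z1 Fnat F1z2 !Fnat mulrA -natrM mulr_natl scaler_nat.
  rewrite minor2_cons D1 sbar3 // F3 ?scalerA ?mulVf ?pnatr_eq0 ?scale1r //.
  by rewrite FZ F1z4 scaler0.
have D3 : Delta [:: r2; r1; r2] = z7.
  by rewrite minor2_cons D2 sbar2 // -/k F2k Fnat F2z7 mulr0.
have D4 : Delta [:: r1; r2; r1; r2] = zb.
  have F3 : F r1 (F r1 (F r1 z7)) = 6 *: zb.
    by rewrite F1z7 Fnat F1x !Fnat mulrA -natrM mulr_natl scaler_nat.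
  rewrite minor2_cons D3 sbar3 // F3 ?scalerA ?mulVf ?pnatr_eq0 ?scale1r //.
  by rewrite FZ F1zb scaler0.
have D5 : Delta [:: r2; r1; r2; r1; r2] = zc by rewrite minor2_cons D4 sbar1.
have D6 : Delta w0 = zc by rewrite minor2_cons D5 sbar0.
have f21 : F21 = z2 by rewrite /Defs.F21 D1.
have f11 : F11 = z3 by rewrite /Defs.F11 f21.
have f10 : F10 = z5 by rewrite /Defs.F10 f11.
(* The origin of 2 l - k in the cubics: k and l are F2 F1 and F1 F2 applied to F(1,1). *)
have f00 : F00 = 2 * l - k by rewrite /Defs.F00 f11 scaler_nat mulr_natl.
rewrite D1 D2 D4 D6 f21 f11 f10 f00.
move: z1n0 z3n0 z4n0 An0 relb rela relc.
move: (2 * l - k) (z1) (z2) (z3) (z4) (z5) (zb) (zc).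
move=> f a1 a2 a3 a4 a5 ab ac n1 n3 n4 nA relb rela relc.
split; first exact: And4 n1 n4 n3 nA.
split.
(* This cubic is F(2,1) times the quadratic relation. *)
- transitivity (a2 * (a1 * a3) - f * Delta2 * a1); last by ring.
  by rewrite relb; ring.
- by rewrite [RHS]mulrC rela; ring.
- by rewrite relc.
Qed.

End MinorIdentities.

(** * Fractions and mutation of seeds *)

Local Notation "x %:F" := (FracField.tofrac x).

Lemma tofrac_divE (A : idomainType) (a b c : A) :
  b != 0 -> a = c * b -> a%:F / b%:F = c%:F.
Proof.
by move=> b0 ->; rewrite tofracM mulfK // tofrac_eq0.
Qed.

Lemma ord3_ind (P : 'I_3 -> Prop) : P m1 -> P m2 -> P m3 -> forall k, P k.
Proof.
move=> P1 P2 P3 [[|[|[|//]]] lk]; [move: P1|move: P2|move: P3];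
  by congr P; exact: val_inj.
Qed.

Lemma prod_seed_index (T : fieldType) (f : seed_index -> T) :
  \prod_i f i = f (inl m1) * f (inl m2) * f (inl m3) *
    (f (inr m1) * f (inr m2) * f (inr m3)).
Proof.
have I3 (g : 'I_3 -> T) : \prod_i g i = g m1 * g m2 * g m3.
  rewrite !big_ord_recl big_ord0 mulr1 mulrA.
  by congr (g _ * g _ * g _); exact: val_inj.
by rewrite big_sumType !I3.
Qed.

(** The positive parts of matrix entries recorded as naturals, which turns the integer powers in
    [mutate] into ordinary ones. *)
Definition exponents (em ef : seq nat) (i : seed_index) : nat :=
  match i with inl k => nth 0%N em k | inr k => nth 0%N ef k end.

Lemma mutate_seed_var (T : fieldType) (S : seed T) (k : 'I_3) pm pf qm qf :
  (forall j, Num.max 0 (seed_mx S j k) = exponents pm pf j) ->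
  (forall j, Num.max 0 (- seed_mx S j k) = exponents qm qf j) ->
  seed_var (mutate k S) (inl k) =
    (\prod_j seed_var S j ^+ exponents pm pf j +
     \prod_j seed_var S j ^+ exponents qm qf j) / seed_var S (inl k).
Proof.
move=> pE qE; rewrite /= eqxx; congr ((_ + _) / _).
  by apply: eq_bigr => j _; rewrite pE.
by apply: eq_bigr => j _; rewrite qE.
Qed.

Lemma mutate_seed_var_other (T : fieldType) (S : seed T) (k : 'I_3) i :
  i != inl k -> seed_var (mutate k S) i = seed_var S i.
Proof. by move=> /negbTE ik; rewrite /= ik. Qed.

Theorem mainTheorem5 (R : realType) (n : nat) (D : G2_rep R[i] n)
    (phi : 'I_2 -> 'M[R[i]]_2 -> G2_group D)
    (phi_hom : forall i, is_SL2_hom i (phi i))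
    (Delta2 : regfun D)
    (Delta2_minor : is_principal_minor phi r2 Delta2) :
  let Sigma2_0 := mutate m2 (mutate m3 (Sigma2 phi Delta2)) in
  let Sigma := mutate m1 (mutate m3 (Sigma2_GLS phi Delta2)) in
  (forall i, seed_var Sigma i = seed_var Sigma2_0 i) /\
  (forall i j, seed_mx Sigma i j = - seed_mx Sigma2_0 i j).
Proof.
move=> Sigma2_0 Sigma; split; last first.
  (* Each of the 18 entries is a closed integer computation. *)
  by move=> [[[|[|[|//]]] ?]|[[|[|[|//]]] ?]] [[|[|[|//]]] ?].
have [[d1n0 d2n0 f11n0 An0] [e1 e2 e3]] :=
  minor_seed_relations phi_hom Delta2_minor.
(* The existential makes [f] opaque, so that the common variable stays folded. *)
have [f fE] : exists f,
    f = F11 phi Delta2 * F21 phi Delta2 - F00 phi Delta2 * Delta2.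
  by eexists.
rewrite -fE in e1 e2 e3.
have s3 : seed_var (mutate m3 (Sigma2 phi Delta2)) (inl m3) = f%:F.
  (* [pm], [pf] and [qm], [qf] list the positive and negative parts of column 3, mutable rows
     first. *)
  rewrite (mutate_seed_var (pm := [:: 1; 0; 0]) (pf := [:: 0; 0; 2])
    (qm := [:: 0; 3; 0]) (qf := [:: 0; 0; 0])%N).
  2,3: by move=> [[[|[|[|//]]] ?]|[[|[|[|//]]] ?]].
  rewrite !prod_seed_index !(expr0, expr1, mul1r, mulr1) -(tofrac_divE d2n0 e2).
  by rewrite !(tofracD, tofracM, tofracXn).
have s3' : seed_var (mutate m3 (Sigma2_GLS phi Delta2)) (inl m3) = f%:F.
  rewrite (mutate_seed_var (pm := [:: 1; 0; 0]) (pf := [:: 0; 0; 1])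
    (qm := [:: 0; 3; 0]) (qf := [:: 0; 0; 0])%N).
  2,3: by move=> [[[|[|[|//]]] ?]|[[|[|[|//]]] ?]].
  rewrite !prod_seed_index !(expr0, expr1, mul1r, mulr1) -(tofrac_divE d1n0 e1).
  by rewrite tofracD tofracM tofracXn.
have s2 : seed_var Sigma2_0 (inl m2) = (F21 phi Delta2)%:F.
  (* Column 2 is read after mu_3, which has cancelled its entry in row 1 and changed the one in row
     -3 from -1 to 1. *)
  rewrite (mutate_seed_var (pm := [:: 0; 0; 0]) (pf := [:: 0; 1; 1])
    (qm := [:: 0; 0; 1]) (qf := [:: 0; 0; 0])%N).
  2,3: by move=> [[[|[|[|//]]] ?]|[[|[|[|//]]] ?]].
  rewrite !prod_seed_index !(expr0, expr1, mul1r, mulr1) s3.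
  have e : F00 phi Delta2 * Delta2 + f = F21 phi Delta2 * F11 phi Delta2.
    by rewrite fE addrC subrK mulrC.
  by rewrite -(tofrac_divE f11n0 e) tofracD tofracM.
have s1 : seed_var Sigma (inl m1) = (minor2 phi Delta2 [:: r1; r2; r1; r2])%:F.
  rewrite (mutate_seed_var (pm := [:: 0; 0; 1]) (pf := [:: 1; 0; 0])
    (qm := [:: 0; 0; 0]) (qf := [:: 0; 3; 0])%N).
  2,3: by move=> [[[|[|[|//]]] ?]|[[|[|[|//]]] ?]].
  rewrite !prod_seed_index !(expr0, expr1, mul1r, mulr1) s3'.
  by rewrite -(tofrac_divE An0 e3) tofracD tofracM tofracXn.
case; apply: ord3_ind.
- by rewrite [LHS]s1 !mutate_seed_var_other.
- by rewrite [RHS]s2 !mutate_seed_var_other.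
- by rewrite [LHS]s3' [RHS]s3.
- by rewrite !mutate_seed_var_other.
- by rewrite !mutate_seed_var_other.
- by rewrite !mutate_seed_var_other.
Qed.
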